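(* Assume that the set $\{t>0 : G(t),G'(t),G''(t)<\infty \text{ and } (G(t)-tG'(t))^2 = 2t^2 G(t)G''(t)\}$ is nonempty, and let $t_c$ be its infimum. Then the parking process is subcritical if and only if $$ t_c>1 \qquad\text{and}\qquad \frac{t_c\, G(t_c)}{\varphi(t_c)^2}\le q(1-q),$$ where $\varphi(y) = (y+1)G(y) - y(y-1)G'(y)$.
   Context: Fix $q\in(1/2,1)$. Let $\mathcal T$ be a Bienaymé–Galton–Watson plane tree rooted at $\varnothing$ with geometric offspring distribution $\nu(k)=q^k(1-q)$, $k\ge 0$ (mean $q/(1-q)>1$, so $\mathcal T$ is infinite with positive probability). Let $\mu$ be a probability law on $\{0,1,2,\dots\}$ with $\mu(\{0,1\})<1$, write $\mu_k=\mu(\{k\})$ and $G(t)=\sum_{k\ge0}\mu_k t^k$. Conditionally on $\mathcal T$, let $(A_u)_{u\in\mathcal T}$ be i.i.d. with law $\mu$; $A_u$ is the number of cars arriving at vertex $u$. Parking rule: each vertex can hold at most one car; each car goes to its arrival vertex, parks there if it is free, otherwise drives towards the root and parks at the first free vertex on its way; if it finds none it exits through the root. On a finite tree the final configuration does not depend on the order of the cars. For general $\mathcal T$: for $n\ge 0$ let $[\mathcal T]_n$ be the subtree of vertices at height at most $n$, park only the cars arriving on $[\mathcal T]_n$, and let $X_n(u)$ be the number of cars visiting $u$ (i.e. arriving at $u$ or reaching $u$ while driving towards the root); $X_n(u)$ is nondecreasing in $n$ and $X(u):=\lim_n X_n(u)\in\{0,1,\dots\}\cup\{\infty\}$. Set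 $X:=X(\varnothing)$, the number of cars visiting the root. The parking process is called subcritical if $X<\infty$ almost surely, and supercritical otherwise. *)

(* Defs.v *)
From HB Require Import structures.
From mathcomp Require Import all_boot all_order all_algebra.
From mathcomp Require Import all_classical all_reals all_analysis.
Set Implicit Arguments. Unset Strict Implicit. Unset Printing Implicit Defensive.
Import Order.TTheory GRing.Theory Num.Theory.
Import numFieldNormedType.Exports.
Local Open Scope classical_set_scope.
Local Open Scope ring_scope.

(* Vertices are Ulam–Harris words (seq nat); the root is [::] and the i-th
   child (i = 0, 1, ...) of u is rcons u i. *)

(* Number of cars visiting u when parking only the cars of the subtree of u
   truncated at [depth] further generations below u.  [k u] is the number of
   children of u, [A u] the number of cars arriving at u.  A subtree rooted at
   a child v lets (visits v - 1)_+ cars out towards its parent (truncated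
   subtraction on nat). *)
Fixpoint visits (k A : seq nat -> nat) (depth : nat) (u : seq nat) : nat :=
  match depth with
  | 0 => A u
  | d.+1 => (A u + \sum_(i < k u) (visits k A d (rcons u i) - 1))%N
  end.

Definition Xn (k A : seq nat -> nat) (n : nat) : nat := visits k A n [::].

Section GF.
Variable R : realType.
Local Open Scope ereal_scope.
Definition Gf (mu : nat -> R) (t : R) : \bar R :=
  \sum_(j <oo) ((mu j * t ^+ j)%R)%:E.
Definition G1 (mu : nat -> R) (t : R) : \bar R :=
  \sum_(j <oo) ((j%:R * mu j * t ^+ j.-1)%R)%:E.
Definition G2 (mu : nat -> R) (t : R) : \bar R :=
  \sum_(j <oo) ((j%:R * (j.-1)%:R * mu j * t ^+ j.-2)%R)%:E.
End GF.

Definition crit_set (R : realType) (mu : nat -> R) : set R :=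
  [set t | 0 < t /\ (Gf mu t < +oo)%E /\ (G1 mu t < +oo)%E /\ (G2 mu t < +oo)%E /\
     (fine (Gf mu t) - t * fine (G1 mu t)) ^+ 2
       = 2 * t ^+ 2 * fine (Gf mu t) * fine (G2 mu t)].

Definition phi (R : realType) (mu : nat -> R) (y : R) : R :=
  (y + 1) * fine (Gf mu y) - y * (y - 1) * fine (G1 mu y).

Definition prob_law_nat (R : realType) (mu : nat -> R) : Prop :=
  (forall j, 0 <= mu j) /\ series mu @ \oo --> (1 : R).

(* Joint law: (k_u)_{u word} i.i.d. geometric(q) (nu(j) = q^j (1-q)),
   (A_u)_{u word} i.i.d. with law mu, the two families independent.
   Stated as the product rule on every finite family of distinct words. *)
Definition GW_parking_law (d : measure_display) (T : measurableType d)
  (R : realType) (P : probability T R) (q : R) (mu : nat -> R)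
  (k A : seq nat -> T -> nat) : Prop :=
  (forall u j, measurable [set w | k u w = j]) /\
  (forall u j, measurable [set w | A u w = j]) /\
  (forall (s : seq (seq nat)) (kf af : seq nat -> nat), uniq s ->
     P (\bigcap_(u in [set` s]) [set w | k u w = kf u /\ A u w = af u])
     = (\prod_(u <- s) (q ^+ kf u * (1 - q) * mu (af u)))%:E).

(* Subcritical: X = lim_n X_n < oo almost surely. *)
Definition subcritical (d : measure_display) (T : measurableType d)
  (R : realType) (P : probability T R) (k A : seq nat -> T -> nat) : Prop :=
  {ae P, forall w, exists K : nat, forall n, (Xn (k^~ w) (A^~ w) n <= K)%N}.

(* Main.v *)
Require Import Defs.
From HB Require Import structures.
From mathcomp Require Import all_boot all_order all_algebra.
From mathcomp Require Import all_classical all_reals all_analysis.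
From mathcomp Require Import ring lra.
Import Order.TTheory GRing.Theory Num.Theory.
Import numFieldNormedType.Exports.
Local Open Scope classical_set_scope.
Local Open Scope ring_scope.

(** Let X be the number of visits at the root, F(x) = E[x^X; X < oo],
    c = q P(X = 0), l(x) = x - c (x - 1) and H(x) = x G(x).  The recursion at the
    root reads q F^2 - l F + (1 - q) H = 0, with discriminant
    l^2 - 4 q (1 - q) H.  The critical equation says that r = sqrt H has an
    inflection point: r is concave before t_c and convex after.  Since
    phi(y) / (2 r(y)) is the value at 1 of the tangent to r at y, the criterion
    says that, at the point 1, the tangent to r at t_c is at least
    1 / (2 sqrt (q (1 - q))).

    Necessity.  If F(1) = 1, then F is the larger root at 1 because q > 1/2.  As
    long as F is the larger root, the tails of its coefficients decay
    geometrically, so F extends further to the right.  It cannot be the larger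
    root at some x >= t_c: where r is convex, sqrt (l^2 - 4 q (1 - q) r^2) is
    concave, whereas F'' > 0.  Hence t_c > 1 and the discriminant vanishes at some
    x in (1, t_c], where l is tangent to 2 sqrt (q (1 - q)) r; concavity moves the
    tangency point to t_c.

    Sufficiency.  Decrease q and consider the set of all s in [0, q] such that
    E[t_c^X_n] is bounded in n for the parameter s.  It contains 0.  It is closed,
    because F(t_c) <= l(t_c) / (2 s) by the previous argument.  It is open in
    [0, q), because there F(t_c) is strictly smaller than l(t_c) / (2 s), hence is
    a stable fixed point of the recursion, and P(X_n = 0) is nonincreasing
    in n. *)

(** * Power series with nonnegative coefficients *)

Section NonnegativePowerSeries.
Variable R : realType.
Implicit Types (b c nu : nat -> R) (a x y t M : R) (n j : nat).

Lemma cvgn_le (u v : nat -> R) (l m : R) : u @ \oo --> l -> v @ \oo --> m ->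
  (forall n, u n <= v n) -> l <= m.
Proof. by move=> ul vm uv; apply: (ler_cvg_to ul vm); apply: nearW. Qed.

Lemma cvgn_eq (u : nat -> R) (l m : R) : u @ \oo --> l -> u @ \oo --> m -> l = m.
Proof. by move=> ul um; rewrite -(cvg_lim _ ul) // -(cvg_lim _ um). Qed.

Definition gf b x : R := limn (pseries b x).

Lemma pseriesE b x n : pseries b x n = \sum_(i < n) b i * x ^+ i.
Proof. by rewrite /pseries /series /= big_mkord. Qed.

Lemma pseriesS b x n : pseries b x n.+1 = pseries b x n + b n * x ^+ n.
Proof. by rewrite !pseriesE big_ord_recr. Qed.

Lemma pseries_nondecreasing b x : (forall j, 0 <= b j) -> 0 <= x ->
  nondecreasing_seq (pseries b x).
Proof.
move=> b0 x0; apply/nondecreasing_seqP => n.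
by rewrite pseriesS lerDl mulr_ge0 // exprn_ge0.
Qed.

Lemma pseries_bounded_cvg b x M : (forall j, 0 <= b j) -> 0 <= x ->
  (forall n, pseries b x n <= M) -> cvgn (pseries b x).
Proof.
move=> b0 x0 bM; apply: nondecreasing_is_cvgn.
  exact: pseries_nondecreasing.
by exists M => _ [n _ <-].
Qed.

Lemma gf_le_bound b x M : cvgn (pseries b x) ->
  (forall n, pseries b x n <= M) -> gf b x <= M.
Proof. by move=> cb bM; apply: limr_le => //; apply: nearW. Qed.

Lemma pseries_le_gf b x n : (forall j, 0 <= b j) -> 0 <= x ->
  cvgn (pseries b x) -> pseries b x n <= gf b x.
Proof.
by move=> b0 x0 cb; apply: nondecreasing_cvgn_le => //; apply: pseries_nondecreasing.
Qed.

Lemma pseries_ge0 b x n : (forall j, 0 <= b j) -> 0 <= x -> 0 <= pseries b x n.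
Proof.
by move=> b0 x0; rewrite pseriesE sumr_ge0 // => i _; rewrite mulr_ge0 // exprn_ge0.
Qed.

Lemma gf_ge0 b x : (forall j, 0 <= b j) -> 0 <= x -> cvgn (pseries b x) ->
  0 <= gf b x.
Proof. by move=> b0 x0 /(pseries_le_gf b x 0 b0 x0); rewrite pseriesE big_ord0. Qed.

Lemma term_le_gf b x j : (forall i, 0 <= b i) -> 0 <= x -> cvgn (pseries b x) ->
  b j * x ^+ j <= gf b x.
Proof.
move=> b0 x0 cb; apply: le_trans (pseries_le_gf b x j.+1 b0 x0 cb).
by rewrite pseriesS lerDr pseries_ge0.
Qed.

Lemma pseries_le b x y n : (forall j, 0 <= b j) -> 0 <= x -> x <= y ->
  pseries b x n <= pseries b y n.
Proof.
move=> b0 x0 xy; rewrite !pseriesE ler_sum // => i _.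
by rewrite ler_wpM2l // lerXn2r // nnegrE (le_trans x0).
Qed.

Lemma pseries_cvg_le b x y : (forall j, 0 <= b j) -> 0 <= x -> x <= y ->
  cvgn (pseries b y) -> cvgn (pseries b x).
Proof.
move=> b0 x0 xy cb; apply: (@pseries_bounded_cvg b x (gf b y)) => // n.
apply: le_trans (pseries_le b x y n b0 x0 xy) _.
by apply: pseries_le_gf => //; apply: le_trans xy.
Qed.

Lemma gf_le b x y : (forall j, 0 <= b j) -> 0 <= x -> x <= y ->
  cvgn (pseries b y) -> gf b x <= gf b y.
Proof.
move=> b0 x0 xy cb; apply: gf_le_bound; first exact: pseries_cvg_le cb.
move=> n; apply: le_trans (pseries_le b x y n b0 x0 xy) _.
by apply: pseries_le_gf => //; apply: le_trans xy.
Qed.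

Lemma pseries0 b n : pseries b 0 n.+1 = b 0%N.
Proof.
rewrite pseriesE big_ord_recl /= expr0 mulr1 big1 ?addr0 // => i _.
by rewrite exprS mul0r mulr0.
Qed.

Lemma gf_at0 b : gf b 0 = b 0%N.
Proof.
apply/cvg_lim => //; apply: cvg_near_cst; exists 1%N => // n /= n1.
by case: n n1 => // n _; rewrite pseries0.
Qed.

Lemma cvg_pseries0 b : cvgn (pseries b 0).
Proof.
apply/cvg_ex; exists (b 0%N); apply: cvg_near_cst.
by exists 1%N => // n /= n1; case: n n1 => // n _; rewrite pseries0.
Qed.

(** * Tails, and continuity up to the end point of convergence *)

Lemma gf_tail_le b x t n : (forall j, 0 <= b j) -> 0 <= x -> x <= t ->
  cvgn (pseries b t) ->
  0 <= gf b x - pseries b x n <= gf b t - pseries b t n.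
Proof.
move=> b0 x0 xt cb; have t0 := le_trans x0 xt.
have cx : cvgn (pseries b x) by exact: pseries_cvg_le cb.
rewrite subr_ge0 pseries_le_gf //=.
rewrite lerBlDr; apply: gf_le_bound => // m.
rewrite -lerBlDr; case: (leqP n m) => [nm|/ltnW mn]; last first.
  apply: (@le_trans _ _ 0); last by rewrite subr_ge0 pseries_le_gf.
  by rewrite subr_le0 pseries_nondecreasing.
apply: (@le_trans _ _ (pseries b t m - pseries b t n)); last first.
  by rewrite lerB // pseries_le_gf.
rewrite /pseries !sub_series_geq //= ler_sum // => i _.
by rewrite ler_wpM2l // lerXn2r // nnegrE.
Qed.

Lemma pseries_continuous b n : continuous (pseries b ^~ n : R -> R).
Proof.
elim: n => [|n IH] x.
  rewrite (_ : (fun y => _) = cst 0); first exact: cvg_cst.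
  by apply/funext => y; rewrite pseriesE big_ord0.
rewrite (_ : (fun y => _) = (pseries b ^~ n) \+ (fun y => b n * y ^+ n)).
  by apply: cvgD; [exact: IH|apply: cvgM; [exact: cvg_cst|exact: exprn_continuous]].
by apply/funext => y; rewrite pseriesS.
Qed.

(** By [gf_tail_le] the polynomials [pseries b ^~ n] converge uniformly on [0, t]. The end point t
    is included because t_c may be the radius of convergence. *)
Lemma gf_continuous b t : (forall j, 0 <= b j) -> cvgn (pseries b t) ->
  {within `[0, t], continuous (gf b)}.
Proof.
move=> b0 cb; apply/subspace_continuousP => x; rewrite /= in_itv /= => /andP[x0 xt].
apply/cvgrPdist_lt => e e0.
have [N tailN] : exists N, gf b t - pseries b t N < e / 3.
  have /cvgrPdist_lt/(_ (e / 3)) := cb; rewrite divr_gt0 // => /(_ isT)[N _ HN].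
  exists N; apply: le_lt_trans (HN N (leqnn N)); exact: ler_norm.
have := pseries_continuous b N x; move/cvgrPdist_lt/(_ (e / 3)).
rewrite divr_gt0 // => /(_ isT) nearx.
apply: (filterS _ nearx) => y /= g5; rewrite in_itv /= => /andP[y0 yt].
have key (u v pu pv d : R) : `|pu - pv| < e / 3 -> d < e / 3 ->
    0 <= u - pu <= d -> 0 <= v - pv <= d -> `|u - v| < e.
  rewrite !ltr_norml => /andP[? ?] ? /andP[? ?] /andP[? ?].
  by apply/andP; split; lra.
by apply: key g5 tailN _ _; apply: gf_tail_le.
Qed.

Lemma gf_cvg_within b x t z : (forall j, 0 <= b j) -> 0 <= x ->
  cvgn (pseries b t) -> `[x, t]%classic z ->
  gf b @ within `[x, t] (nbhs z) --> gf b z.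
Proof.
move=> b0 x0 cb; have sub : `[x, t] `<=` `[0, t].
  by apply: subset_itvr; rewrite bnd_simp.
have /subspace_continuousP := continuous_subspaceW sub (gf_continuous b t b0 cb).
exact.
Qed.

Lemma is_derive_gt0_lt (f df : R -> R) x y : x < y ->
  (forall z, x < z -> z < y -> is_derive z 1 f (df z)) ->
  {within `[x, y], continuous f} ->
  (forall z, x < z -> z < y -> 0 < df z) -> f x < f y.
Proof.
move=> xy der cf pos; have der' z : z \in `]x, y[ -> is_derive z 1 f (df z).
  by rewrite in_itv /= => /andP[xz zy]; exact: der.
have [z] := MVT xy der' cf; rewrite in_itv /= => /andP[xz zy] E.
by rewrite -subr_gt0 E mulr_gt0 ?subr_gt0 ?pos.
Qed.

(** * The derived series *)

Lemma expr_sub_ge x t n : 0 <= x -> x <= t ->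
  n.+1%:R * x ^+ n * (t - x) <= t ^+ n.+1 - x ^+ n.+1.
Proof.
move=> x0 xt; rewrite subrXX mulrC ler_wpM2l ?subr_ge0 //.
rewrite -[n.+1 in X in X <= _]card_ord -sumr_const mulr_suml ler_sum // => i _.
have {1}-> : n = (n - i + i)%N by rewrite subnK // -ltnS.
rewrite mul1r exprD.
by rewrite ler_wpM2r ?exprn_ge0 // lerXn2r // nnegrE (le_trans x0).
Qed.

Lemma expr_sub_le x t n : 0 <= x -> x <= t ->
  t ^+ n.+1 - x ^+ n.+1 <= n.+1%:R * t ^+ n * (t - x).
Proof.
move=> x0 xt; rewrite subrXX mulrC ler_wpM2r ?subr_ge0 //.
rewrite -[n.+1 in X in _ <= X]card_ord -sumr_const mulr_suml ler_sum // => i _.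
have -> : t ^+ n = t ^+ (n - i) * t ^+ i by rewrite -exprD subnK // -ltnS.
rewrite mul1r.
have t0 := le_trans x0 xt.
by rewrite ler_wpM2l ?exprn_ge0 // lerXn2r // nnegrE.
Qed.

Lemma pseries_diffs_ge0 b : (forall j, 0 <= b j) ->
  forall j, 0 <= pseries_diffs b j.
Proof. by move=> b0 j; rewrite mulr_ge0. Qed.

Lemma pseriesS_l b x n :
  pseries b x n.+1 = b 0%N + \sum_(i < n) b i.+1 * x ^+ i.+1.
Proof. by rewrite pseriesE big_ord_recl expr0 mulr1. Qed.

Lemma pseries_diffs_bound b x t n : (forall j, 0 <= b j) -> 0 <= x -> x <= t ->
  pseries (pseries_diffs b) x n * (t - x) <=
  pseries b t n.+1 - pseries b x n.+1.
Proof.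
move=> b0 x0 xt; rewrite !pseriesS_l opprD addrACA subrr add0r -sumrB.
rewrite pseriesE mulr_suml ler_sum // => i _.
rewrite /pseries_diffs -mulrBr mulrAC [_ * b _]mulrC -!mulrA ler_wpM2l //.
by rewrite [(_ - _) * _]mulrC mulrA expr_sub_ge.
Qed.

Lemma pseries_diffs_bound_le b x t n : (forall j, 0 <= b j) -> 0 <= x -> x <= t ->
  pseries b t n.+1 - pseries b x n.+1 <=
  pseries (pseries_diffs b) t n * (t - x).
Proof.
move=> b0 x0 xt; rewrite !pseriesS_l opprD addrACA subrr add0r -sumrB.
rewrite pseriesE mulr_suml ler_sum // => i _.
rewrite /pseries_diffs -mulrBr mulrAC [_ * b _]mulrC -!mulrA ler_wpM2l //.
by rewrite [(_ - _) * _]mulrC mulrA expr_sub_le.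
Qed.

(** By convexity of the powers, the increment of the series from x to t dominates t - x times the
    derived series at x. *)
Lemma cvg_pseries_diffs b x t : (forall j, 0 <= b j) -> 0 <= x -> x < t ->
  cvgn (pseries b t) -> cvgn (pseries (pseries_diffs b) x).
Proof.
move=> b0 x0 xt cb; have t0 := ltW (le_lt_trans x0 xt).
apply: (@pseries_bounded_cvg _ _ (gf b t / (t - x))) => //.
  exact: pseries_diffs_ge0.
move=> n; rewrite ler_pdivlMr ?subr_gt0 //.
apply: le_trans (pseries_diffs_bound b x t n b0 x0 (ltW xt)) _.
apply: le_trans (pseries_le_gf b t n.+1 b0 t0 cb).
by rewrite gerBl pseries_ge0.
Qed.

Lemma cvg_pseriesS b x : cvgn (pseries b x) -> pseries b x n.+1 @[n --> \oo] --> gf b x.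
Proof. by move=> cb; rewrite (cvg_shiftS (pseries b x)). Qed.

(** Convexity replaces differentiability at t, beyond which the series may diverge;
    [bounded_bra_lt0] uses this at t_c. *)
Lemma gf_sub_le b x t : (forall j, 0 <= b j) -> 0 <= x -> x <= t ->
  cvgn (pseries b t) -> cvgn (pseries (pseries_diffs b) t) ->
  gf b t - gf b x <= gf (pseries_diffs b) t * (t - x).
Proof.
move=> b0 x0 xt cb cd; have cx : cvgn (pseries b x) by apply: pseries_cvg_le cb.
apply: (@cvgn_le
  (fun n => pseries b t n.+1 - pseries b x n.+1)
  (fun n => pseries (pseries_diffs b) t n * (t - x)) _ _).
- by apply: cvgB; apply: cvg_pseriesS.
- by apply: cvgMl.
- by move=> n; apply: pseries_diffs_bound_le.
Qed.

Lemma gf_is_derive b x t : (forall j, 0 <= b j) -> 0 <= x -> x < t ->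
  cvgn (pseries b t) -> is_derive x 1 (gf b) (gf (pseries_diffs b) x).
Proof.
(* [pseries_snd_diffs] requires two derived series to converge beyond x, and each differentiation
   costs one step d to the left of t. *)
move=> b0 x0 xt cb; pose d := (t - x) / 3.
have d0 : 0 < d by rewrite divr_gt0 // subr_gt0.
have td : t = x + d + d + d by rewrite /d; field.
have b1 := pseries_diffs_ge0 b b0.
have c1 : cvgn (pseries (pseries_diffs b) (x + d + d)).
  by apply: (@cvg_pseries_diffs b _ t) => //; lra.
have c2 : cvgn (pseries (pseries_diffs (pseries_diffs b)) (x + d)).
  by apply: (@cvg_pseries_diffs _ _ (x + d + d)) => //; lra.
apply: (@pseries_snd_diffs _ b (x + d)) => //.
- by apply: (@pseries_cvg_le b _ t) => //; lra.
- by apply: (@pseries_cvg_le _ _ (x + d + d)) => //; lra.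
- by rewrite !ger0_norm; lra.
Qed.

(** * Cauchy products *)

Definition cprod b c j : R := \sum_(i < j.+1) b i * c (j - i)%N.

Lemma cprodC b c j : cprod b c j = cprod c b j.
Proof.
rewrite /cprod (reindex_inj rev_ord_inj) /=; apply: eq_bigr => i _.
by rewrite mulrC subSS subKn // -ltnS.
Qed.

Lemma cprod_ge0 b c : (forall j, 0 <= b j) -> (forall j, 0 <= c j) ->
  forall j, 0 <= cprod b c j.
Proof. by move=> b0 c0 j; rewrite sumr_ge0 // => i _; rewrite mulr_ge0. Qed.

Lemma sum_cprod b c n :
  \sum_(j < n) cprod b c j = \sum_(i < n) b i * \sum_(j < n - i) c j.
Proof.
elim: n => [|n IH]; first by rewrite !big_ord0.
rewrite big_ord_recr /= IH [in RHS]big_ord_recr /= subSnn big_ord1.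
rewrite /cprod big_ord_recr /= subnn addrA -big_split /=; congr (_ + _).
apply: eq_bigr => i _; rewrite -mulrDr; congr (_ * _).
by rewrite subSn ?(ltnW (ltn_ord i)) // big_ord_recr.
Qed.

Lemma cprod_exprM b c x j :
  cprod b c j * x ^+ j = cprod (fun i => b i * x ^+ i) (fun i => c i * x ^+ i) j.
Proof.
rewrite mulr_suml; apply: eq_bigr => i _.
by rewrite mulrACA -exprD subnKC // -ltnS.
Qed.

Lemma pseries_cprod b c x n :
  pseries (cprod b c) x n = \sum_(i < n) b i * x ^+ i * pseries c x (n - i)%N.
Proof.
rewrite pseriesE; under eq_bigr => j _ do rewrite cprod_exprM.
by rewrite sum_cprod; apply: eq_bigr => i _; rewrite pseriesE.
Qed.

Lemma pseries_cprod_le b c x n : (forall j, 0 <= b j) -> (forall j, 0 <= c j) ->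
  0 <= x -> pseries (cprod b c) x n <= pseries b x n * pseries c x n.
Proof.
move=> b0 c0 x0; rewrite pseries_cprod (pseriesE b) mulr_suml ler_sum // => i _.
rewrite ler_wpM2l ?mulr_ge0 ?exprn_ge0 //.
by apply: pseries_nondecreasing => //; exact: leq_subr.
Qed.

(** The square i, j < n lies in the triangle i + j < n + n. The opposite bound holds because the
    triangle i + j < n lies in the square. *)
Lemma pseries_cprod_ge b c x n : (forall j, 0 <= b j) -> (forall j, 0 <= c j) ->
  0 <= x -> pseries b x n * pseries c x n <= pseries (cprod b c) x (n + n).
Proof.
move=> b0 c0 x0; rewrite pseries_cprod (pseriesE b) mulr_suml big_split_ord /=.
rewrite -[leLHS]addr0 lerD //.
  rewrite ler_sum // => i _; rewrite ler_wpM2l ?mulr_ge0 ?exprn_ge0 //.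
  apply: pseries_nondecreasing => //.
  by rewrite -addnBA ?leq_addr // ltnW.
by rewrite sumr_ge0 // => i _; rewrite !mulr_ge0 ?exprn_ge0 ?pseries_ge0.
Qed.

Lemma cvg_pseries_cprod b c x : (forall j, 0 <= b j) -> (forall j, 0 <= c j) ->
  0 <= x -> cvgn (pseries b x) -> cvgn (pseries c x) ->
  cvgn (pseries (cprod b c) x).
Proof.
move=> b0 c0 x0 cb cc.
apply: (@pseries_bounded_cvg _ _ (gf b x * gf c x)) => //; first exact: cprod_ge0.
move=> n; apply: le_trans (pseries_cprod_le b c x n b0 c0 x0) _.
by rewrite ler_pM ?pseries_ge0 ?pseries_le_gf.
Qed.

Lemma gf_cprod b c x : (forall j, 0 <= b j) -> (forall j, 0 <= c j) ->
  0 <= x -> cvgn (pseries b x) -> cvgn (pseries c x) ->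
  gf (cprod b c) x = gf b x * gf c x.
Proof.
move=> b0 c0 x0 cb cc; have cd := cvg_pseries_cprod b c x b0 c0 x0 cb cc.
have d0 := cprod_ge0 b c b0 c0.
apply/eqP; rewrite eq_le; apply/andP; split.
  apply: gf_le_bound => // n; apply: le_trans (pseries_cprod_le b c x n b0 c0 x0) _.
  by rewrite ler_pM ?pseries_ge0 ?pseries_le_gf.
have cm : pseries b x n * pseries c x n @[n --> \oo] --> gf b x * gf c x.
  by apply: cvgM.
rewrite -(cvg_lim _ cm) //; apply: limr_le; first by apply/cvg_ex; eexists; exact: cm.
apply: nearW => n; apply: le_trans (pseries_cprod_ge b c x n b0 c0 x0) _.
by rewrite pseries_le_gf.
Qed.

Lemma pseriesD b c x n :
  pseries (fun j => b j + c j) x n = pseries b x n + pseries c x n.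
Proof.
by rewrite !pseriesE -big_split /=; apply: eq_bigr => i _; rewrite mulrDl.
Qed.

Lemma pseriesZ a b x n : pseries (fun j => a * b j) x n = a * pseries b x n.
Proof. by rewrite !pseriesE mulr_sumr; apply: eq_bigr => i _; rewrite mulrA. Qed.

Lemma cvg_pseriesD b c x : cvgn (pseries b x) -> cvgn (pseries c x) ->
  pseries (fun j => b j + c j) x @ \oo --> gf b x + gf c x.
Proof.
move=> cb cc; rewrite (_ : pseries _ x = pseries b x \+ pseries c x).
  exact: cvgD.
by apply/funext => n; rewrite pseriesD.
Qed.

Lemma cvg_pseriesZ a b x : cvgn (pseries b x) ->
  pseries (fun j => a * b j) x @ \oo --> a * gf b x.
Proof.
move=> cb; rewrite (_ : pseries _ x = (fun n => a * pseries b x n)).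
  by apply: cvgMr.
by apply/funext => n; rewrite pseriesZ.
Qed.

Lemma gfD b c x : cvgn (pseries b x) -> cvgn (pseries c x) ->
  gf (fun j => b j + c j) x = gf b x + gf c x.
Proof. by move=> cb cc; apply/cvg_lim => //; exact: cvg_pseriesD. Qed.

Lemma gfZ a b x : cvgn (pseries b x) -> gf (fun j => a * b j) x = a * gf b x.
Proof. by move=> cb; apply/cvg_lim => //; exact: cvg_pseriesZ. Qed.

Lemma gf_fix nu b c x : (forall j, 0 <= b j) -> (forall j, 0 <= c j) ->
  (forall j, c j = nu j + cprod b c j) -> 0 <= x -> cvgn (pseries nu x) ->
  cvgn (pseries b x) -> cvgn (pseries c x) ->
  gf c x = gf nu x + gf b x * gf c x.
Proof.
move=> b0 c0 fixc x0 cn cb cc; rewrite -gf_cprod // -gfD //.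
  by congr (gf _ x); apply/funext => j; exact: fixc.
exact: cvg_pseries_cprod.
Qed.

Lemma is_cvg_pseriesZ a b x : cvgn (pseries b x) ->
  cvgn (pseries (fun j => a * b j) x).
Proof. by move=> cb; apply/cvg_ex; eexists; exact: cvg_pseriesZ. Qed.

Lemma gf_recl b x : cvgn (pseries (fun j => b j.+1) x) ->
  pseries b x @ \oo --> b 0%N + x * gf (fun j => b j.+1) x.
Proof.
move=> cb; rewrite -cvg_shiftS.
rewrite (_ : (fun n => _) = (fun n => b 0%N + x * pseries (fun j => b j.+1) x n)).
  by apply: cvgD; [exact: cvg_cst|exact: cvgMr].
apply/funext => n; rewrite pseriesS_l pseriesE mulr_sumr; congr (_ + _).
by apply: eq_bigr => i _; rewrite exprS mulrCA.
Qed.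

End NonnegativePowerSeries.

Arguments gf {R} b x.
Arguments cprod {R} b c j.

(** * The inflection point of the square root of a power series *)

Section Inflection.
Variables (R : realType) (b : nat -> R).
Hypothesis b_ge0 : forall j, 0 <= b j.
Implicit Types (x y t : R).

Lemma gf_gt0 (c : nat -> R) x j : (forall i, 0 <= c i) -> 0 < x -> 0 < c j ->
  cvgn (pseries c x) -> 0 < gf c x.
Proof.
move=> c0 x0 cj cc; apply: lt_le_trans (term_le_gf _ c x j c0 (ltW x0) cc).
by rewrite mulr_gt0 // exprn_gt0.
Qed.

Let b1 := pseries_diffs b.
Let b2 := pseries_diffs b1.
Let b3 := pseries_diffs b2.
Let b1_ge0 : forall j, 0 <= b1 j. Proof. exact: pseries_diffs_ge0. Qed.
Let b2_ge0 : forall j, 0 <= b2 j. Proof. exact: pseries_diffs_ge0. Qed.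
Let b3_ge0 : forall j, 0 <= b3 j. Proof. exact: pseries_diffs_ge0. Qed.

Definition cvg_order2 x :=
  [/\ cvgn (pseries b x), cvgn (pseries b1 x) & cvgn (pseries b2 x)].

Lemma cvg_order2_le x y : 0 <= x -> x <= y -> cvg_order2 y -> cvg_order2 x.
Proof. by move=> x0 xy [? ? ?]; split; apply: pseries_cvg_le xy _. Qed.

Lemma cvg_order2_lt x y : 0 <= x -> x < y -> cvgn (pseries b y) -> cvg_order2 x.
Proof.
move=> x0 xy cb; have m1 : x < (x + y) / 2 by lra.
have m2 : (x + y) / 2 < y by lra.
have cm : cvgn (pseries b1 ((x + y) / 2)).
  by apply: cvg_pseries_diffs m2 cb => //; lra.
split; first by apply: pseries_cvg_le (ltW xy) cb.
  by apply: cvg_pseries_diffs xy cb.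
by apply: cvg_pseries_diffs m1 cm.
Qed.

(* [inflex] has the sign of the second derivative of [sqrt (gf b)]. *)
Definition inflex x := 2 * (gf b x * gf b2 x) - gf b1 x ^+ 2.

Hypothesis b_nontrivial : exists2 j, (3 <= j)%N & 0 < b j.

Let gf_b_gt0 x : 0 < x -> cvgn (pseries b x) -> 0 < gf b x.
Proof. by case: b_nontrivial => j _ bj x0 cb; apply: (gf_gt0 _ _ j). Qed.

Let gf_b1_gt0 x : 0 < x -> cvgn (pseries b1 x) -> 0 < gf b1 x.
Proof.
case: b_nontrivial => -[//|j] _ bj x0 cb; apply: (gf_gt0 _ _ j) => //.
by rewrite mulr_gt0 // ltr0n.
Qed.

Let gf_b3_gt0 x : 0 < x -> cvgn (pseries b3 x) -> 0 < gf b3 x.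
Proof.
case: b_nontrivial => -[|[|[|j]]] // _ bj x0 cb; apply: (gf_gt0 _ _ j) => //.
by rewrite /b3 /b2 /b1 /pseries_diffs !mulr_gt0 // ltr0n.
Qed.

(** With h = [gf b], the terms h' h'' cancel in the derivative of 2 h h'' - h'^2, which leaves 2 h
    h''' > 0. Hence there is at most one inflection point. *)
Lemma inflex_lt x y : 0 <= x -> x < y -> cvg_order2 y -> inflex x < inflex y.
Proof.
move=> x0 xy [c0 c1 c2]; have y0 := le_lt_trans x0 xy.
apply: (@is_derive_gt0_lt _ inflex (fun z => 2 * (gf b z * gf b3 z)) _ _ xy).
- move=> z xz zy; have z0 := ltW (le_lt_trans x0 xz).
  have d0 := gf_is_derive _ b z y b_ge0 z0 zy c0.
  have d1 := gf_is_derive _ b1 z y b1_ge0 z0 zy c1.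
  have d2 := gf_is_derive _ b2 z y b2_ge0 z0 zy c2.
  rewrite /inflex; apply: is_derive_eq.
  by rewrite /GRing.scale /= -/b1 -/b2 -/b3; ring.
- apply/subspace_continuousP => z zin; rewrite /inflex.
  have g0 := gf_cvg_within _ _ _ _ z b_ge0 x0 c0 zin.
  have g1 := gf_cvg_within _ _ _ _ z b1_ge0 x0 c1 zin.
  have g2 := gf_cvg_within _ _ _ _ z b2_ge0 x0 c2 zin.
  by apply: cvgB; [apply: cvgMr; exact: cvgM|exact: cvgM].
- move=> z xz zy; have z0 := le_lt_trans x0 xz.
  rewrite !mulr_gt0 //.
    by apply: gf_b_gt0 => //; apply: pseries_cvg_le (ltW zy) c0 => //; exact: ltW.
  by apply: gf_b3_gt0 => //; apply: cvg_pseries_diffs zy c2 => //; exact: ltW.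
Qed.

Variable t : R.
Hypothesis t_cvg : cvg_order2 t.
Hypothesis t_inflex : inflex t = 0.

(** Four times the squared derivative of sqrt h, for h = [gf b]. Its own derivative is h' [inflex] /
    h^2, negative before t. *)
Let slope2 x := gf b1 x ^+ 2 / gf b x.

Let slope2_lt x y : 0 < x -> x < y -> y <= t -> slope2 y < slope2 x.
Proof.
move=> x0 xy yt; have y0 := lt_trans x0 xy.
have [c0 c1 c2] := cvg_order2_le y t (ltW y0) yt t_cvg.
rewrite -ltrN2.
apply: (@is_derive_gt0_lt _ (fun z => - slope2 z)
  (fun z => - (gf b1 z * inflex z / gf b z ^+ 2)) _ _ xy).
- move=> z xz zy; have z0 := lt_trans x0 xz; have z0' := ltW z0.
  have d0 := gf_is_derive _ b z y b_ge0 z0' zy c0.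
  have d1 := gf_is_derive _ b1 z y b1_ge0 z0' zy c1.
  have p0 : 0 < gf b z by apply: gf_b_gt0 => //; apply: pseries_cvg_le (ltW zy) c0.
  have n0 : gf b z != 0 by rewrite gt_eqF.
  have dV := is_deriveV n0.
  rewrite /slope2; apply: is_derive_eq.
  by rewrite /inflex /GRing.scale /= -/b1 -/b2; field.
- apply/subspace_continuousP => z zin; rewrite /slope2.
  have x0' := ltW x0.
  have g0 := gf_cvg_within _ _ _ _ z b_ge0 x0' c0 zin.
  have g1 := gf_cvg_within _ _ _ _ z b1_ge0 x0' c1 zin.
  apply: cvgN; apply: cvgM; first exact: cvgM.
  apply: cvgV => //; rewrite gt_eqF //.
  move: zin; rewrite /= in_itv /= => /andP[xz zy].
  have z0 := lt_le_trans x0 xz; apply: gf_b_gt0 => //.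
  by apply: pseries_cvg_le zy c0 => //; exact: ltW.
- move=> z xz zy; have z0 := lt_trans x0 xz; have z0' := ltW z0.
  have p0 : 0 < gf b z by apply: gf_b_gt0 => //; apply: pseries_cvg_le (ltW zy) c0.
  have p1 : 0 < gf b1 z.
    by apply: gf_b1_gt0 => //; apply: pseries_cvg_le (ltW zy) c1.
  rewrite oppr_gt0 -mulrA pmulr_rlt0 // pmulr_llt0 ?invr_gt0 ?exprn_gt0 //.
  by rewrite -t_inflex; apply: inflex_lt => //; exact: lt_le_trans yt.
Qed.

(** The derivative of sqrt h; being decreasing up to t, it makes sqrt h strictly concave there. *)
Let slope x := gf b1 x / (2 * Num.sqrt (gf b x)).

Let slope_lt x y : 0 < x -> x < y -> y <= t -> slope y < slope x.
Proof.
move=> x0 xy yt; have y0 := lt_trans x0 xy.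
have pos z : 0 < z -> z <= t -> 0 < gf b z /\ 0 < slope z.
  move=> z0 zt; have [c0 c1 c2] := cvg_order2_le z t (ltW z0) zt t_cvg.
  by rewrite divr_gt0 ?mulr_gt0 ?sqrtr_gt0 ?gf_b_gt0 ?gf_b1_gt0.
have [hx sx] := pos x x0 (le_trans (ltW xy) yt).
have [hy sy] := pos y y0 yt.
have sq z : 0 < gf b z -> slope z ^+ 2 = slope2 z / 4.
  move=> hz; rewrite /slope /slope2 expr_div_n exprMn sqr_sqrtr ?ltW //.
  by field; rewrite gt_eqF.
rewrite -ltr_sqr ?nnegrE ?ltW // !sq //.
by rewrite ltr_pM2r // slope2_lt.
Qed.

Let sqrt_mvt x y : 0 < x -> x < y -> y <= t ->
  exists2 z, x < z < y &
    Num.sqrt (gf b y) - Num.sqrt (gf b x) = slope z * (y - x).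
Proof.
move=> x0 xy yt; have y0 := lt_trans x0 xy.
have [c0 c1 c2] := cvg_order2_le y t (ltW y0) yt t_cvg.
have [||z] := @MVT R (fun z => Num.sqrt (gf b z)) slope x y xy.
- move=> z; rewrite in_itv /= => /andP[xz zy]; have z0 := lt_trans x0 xz.
  have z0' := ltW z0.
  have d0 := gf_is_derive _ b z y b_ge0 z0' zy c0.
  have p0 : 0 < gf b z by apply: gf_b_gt0 => //; apply: pseries_cvg_le (ltW zy) c0.
  have ds := is_derive1_sqrt p0.
  have := is_derive1_comp ds d0; rewrite /slope /comp => dc.
  by apply: is_derive_eq dc _; rewrite mulrC.
- apply/subspace_continuousP => z zin.
  have g0 := gf_cvg_within _ _ _ _ z b_ge0 (ltW x0) c0 zin.
  apply: (@cvg_comp _ _ _ (gf b) Num.sqrt _ _ _ g0); exact: sqrt_continuous.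
by rewrite in_itv /= => zin E; exists z.
Qed.

(** The two equations say that the line of value l and slope s at y is tangent to sqrt (k h). A
    strictly concave function lies below its tangents. *)
Lemma tangent_above (k l s y : R) : 0 < y -> y < t -> 0 < k -> 0 < l ->
  l ^+ 2 = k * gf b y -> k * gf b1 y = 2 * (l * s) ->
  k * gf b t < (l + s * (t - y)) ^+ 2.
Proof.
move=> y0 yt k0 l0 lk tan.
have [c0 c1 c2] := cvg_order2_le y t (ltW y0) (ltW yt) t_cvg.
have hy := gf_b_gt0 y y0 c0.
have [z /andP[yz zt] mvt] := sqrt_mvt y t y0 yt (lexx t).
have sz := slope_lt y z y0 yz (ltW zt).
have kl : Num.sqrt k * Num.sqrt (gf b y) = l.
  by rewrite -sqrtrM ?ltW // -lk sqrtr_sqr gtr0_norm.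
have ks : Num.sqrt k * slope y = s.
  have sy0 : 0 < Num.sqrt (gf b y) by rewrite sqrtr_gt0.
  have sk0 : 0 < Num.sqrt k by rewrite sqrtr_gt0.
  apply: (@mulfI _ (2 * l)); first by rewrite gt_eqF // mulr_gt0.
  rewrite -[RHS]mulrA -tan -kl /slope -{3}[k]sqr_sqrtr ?ltW //.
  by rewrite -/b1; field; rewrite gt_eqF.
have lt1 : Num.sqrt k * Num.sqrt (gf b t) < l + s * (t - y).
  rewrite -kl -ks -mulrA -mulrDr ltr_pM2l ?sqrtr_gt0 // -ltrBlDl mvt.
  by rewrite ltr_pM2r ?subr_gt0.
rewrite -[k]sqr_sqrtr ?ltW // -[gf b t]sqr_sqrtr; last first.
  by apply: gf_ge0 => //; [exact: ltW (lt_trans y0 yt)|case: t_cvg].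
have m0 : 0 <= Num.sqrt k * Num.sqrt (gf b t) by rewrite mulr_ge0 ?sqrtr_ge0.
by rewrite -exprMn ltrXn2r // nnegrE ltW // (le_lt_trans m0).
Qed.

(* Value at [1] of the tangent to [sqrt (gf b)] at [x], times [2]. *)
Definition tangent_at1 x := (2 * gf b x - (x - 1) * gf b1 x) / Num.sqrt (gf b x).

(** The derivative of r(x) - (x - 1) r'(x) is - (x - 1) r''(x), nonnegative where r = sqrt h is
    concave and x >= 1. The mean value theorem for r avoids r''. *)
Lemma tangent_at1_le x y : 1 <= x -> x <= y -> y <= t ->
  tangent_at1 x <= tangent_at1 y.
Proof.
move=> x1; rewrite le_eqVlt => /predU1P[->//|xy] yt.
have x0 := lt_le_trans ltr01 x1; have y0 := lt_trans x0 xy.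
have [z /andP[xz zy] mvt] := sqrt_mvt x y x0 xy yt.
have s1 := slope_lt z y (lt_trans x0 xz) zy yt.
have s2 := slope_lt x y x0 xy yt.
have E w : 0 < w -> w <= t ->
    tangent_at1 w = 2 * (Num.sqrt (gf b w) - slope w * (w - 1)).
  move=> w0 wt; have [c0 _ _] := cvg_order2_le w t (ltW w0) wt t_cvg.
  have hw := gf_b_gt0 w w0 c0; have sw : 0 < Num.sqrt (gf b w) by rewrite sqrtr_gt0.
  rewrite /tangent_at1 /slope -{1}[gf b w]sqr_sqrtr ?ltW //.
  by field; rewrite gt_eqF.
rewrite !E // ?(le_trans (ltW xy)) // ler_pM2l // -subr_ge0.
have -> : Num.sqrt (gf b y) - slope y * (y - 1) - (Num.sqrt (gf b x) - slope x * (x - 1))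
  = slope z * (y - x) - slope y * (y - 1) + slope x * (x - 1) by rewrite -mvt; ring.
(* The expression equals (slope z - slope y) (y - x) + (slope x - slope y) (x - 1). *)
nra.
Qed.

End Inflection.

(** * The fixed point equation *)

Section Shift.
Variable R : realType.
Implicit Types (a mu : nat -> R) (x y : R).

(* law of the truncated difference [X - 1] when [a] is the law of [X] *)
Definition sh a j : R := if j is 0 then a 0%N + a 1%N else a j.+1.

(* coefficients of [x * G x] *)
Definition lag mu j : R := if j is i.+1 then mu i else 0.

Lemma cvg_shift a x : cvgn (pseries a x) -> cvgn (pseries (fun j => a j.+1) x).
Proof.
have [->|x0] := eqVneq x 0; first by move=> _; exact: cvg_pseries0.
move=> ca; rewrite (_ : pseries _ x = (fun n => (pseries a x n.+1 - a 0%N) / x)).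
  apply: is_cvgMl; apply: is_cvgB; last exact: is_cvg_cst.
  by apply/cvg_ex; exists (gf a x); exact: cvg_pseriesS.
apply/funext => n; rewrite pseriesS_l pseriesE addrC addKr mulr_suml.
by apply: eq_bigr => i _; rewrite exprSr mulrA mulfK.
Qed.

Lemma gf_shift a x : cvgn (pseries a x) -> gf a x = a 0%N + x * gf (fun j => a j.+1) x.
Proof. by move=> /cvg_shift/gf_recl/cvg_lim; exact. Qed.

Lemma lag_ge0 mu : (forall j, 0 <= mu j) -> forall j, 0 <= lag mu j.
Proof. by move=> mu0 [|j] /=. Qed.

Lemma cvg_lag mu x : cvgn (pseries mu x) -> cvgn (pseries (lag mu) x).
Proof. by move=> cm; apply/cvg_ex; eexists; exact: (gf_recl _ (lag mu)). Qed.

Lemma gf_lag mu x : cvgn (pseries mu x) -> gf (lag mu) x = x * gf mu x.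
Proof.
by move=> cm; rewrite (gf_shift (lag mu)) ?add0r //; exact: cvg_lag.
Qed.

Lemma sh_ge0 a : (forall j, 0 <= a j) -> forall j, 0 <= sh a j.
Proof. by move=> a0 [|j] /=; rewrite ?addr_ge0. Qed.

(** Truncated version of x E[x^((X-1)_+)] = E[x^X] + P(X = 0) (x - 1): only the value 0 is not
    lowered, whence the correction, and the shift moves the truncation by one. *)
Lemma pseries_sh a x n : x * pseries (sh a) x n.+1 =
  a 0%N * (x - 1) + pseries a x n.+2.
Proof.
rewrite !pseriesS_l [in RHS]big_ord_recl /= expr1 !mulrDr mulr_sumr.
rewrite (_ : \sum_(i < n) x * _ = \sum_(i < n) a i.+2 * x ^+ i.+2); last first.
  by apply: eq_bigr => i _; rewrite mulrCA -exprS.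
have -> : \sum_(i < n) a (bump 0 i).+1 * x ^+ (bump 0 i).+1 = \sum_(i < n) a i.+2 * x ^+ i.+2 by [].
ring.
Qed.

Lemma cvg_sh a x : cvgn (pseries a x) -> cvgn (pseries (sh a) x).
Proof.
have [->|x0] := eqVneq x 0; first by move=> _; exact: cvg_pseries0.
move=> ca; apply/cvg_ex; exists ((a 0%N * (x - 1) + gf a x) / x).
rewrite -cvg_shiftS.
rewrite (_ : (fun n => _) = (fun n => (a 0%N * (x - 1) + pseries a x n.+2) / x)).
  apply: cvgMl; apply: cvgD; first exact: cvg_cst.
  by rewrite (cvg_shiftS (fun n => pseries a x n.+1)); exact: cvg_pseriesS.
by apply/funext => n; rewrite -pseries_sh mulrC mulKf.
Qed.

Lemma gf_sh a x : cvgn (pseries a x) ->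
  x * gf (sh a) x = a 0%N * (x - 1) + gf a x.
Proof.
move=> ca; apply: (@cvgn_eq _ (fun n => x * pseries (sh a) x n.+1)).
  by apply: cvgMr; apply: cvg_pseriesS; exact: cvg_sh.
rewrite (_ : (fun n => _) = (fun n => a 0%N * (x - 1) + pseries a x n.+2)).
  apply: cvgD; first exact: cvg_cst.
  by rewrite (cvg_shiftS (fun n => pseries a x n.+1)); exact: cvg_pseriesS.
by apply/funext => n; rewrite pseries_sh.
Qed.

Lemma geometric_extension a x th C : (forall j, 0 <= a j) -> 0 < x ->
  0 < th -> th < 1 -> (forall n, a n * x ^+ n <= C * th ^+ n) ->
  exists2 y, x < y & cvgn (pseries a y).
Proof.
(* The factor 2 / (1 + th) lies strictly between 1 and 1 / th. *)
move=> a0 x0 th0 th1 bnd; exists (x * (2 / (1 + th))).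
  by rewrite ltr_pMr // ltr_pdivlMr ?addr_gt0 // mul1r; lra.
pose z := 2 * th / (1 + th).
have z1 : `|z| < 1.
  have p : 0 < 1 + th by lra.
  by rewrite ger0_norm ?divr_ge0 ?mulr_ge0 ?ltW // ltr_pdivrMr // mul1r; lra.
have y0 : 0 <= x * (2 / (1 + th)) by rewrite mulr_ge0 ?divr_ge0 // ltW //; lra.
apply: (@series_le_cvg _ _ (geometric C z)) => [n|n|n|] /=.
- by rewrite mulr_ge0 // exprn_ge0.
- rewrite mulr_ge0 //; last by rewrite exprn_ge0 // divr_ge0 // ?mulr_ge0 ?ltW //; lra.
  by have := bnd 0%N; rewrite !expr0 !mulr1; exact: le_trans.
- rewrite exprMn mulrA.
  apply: (@le_trans _ _ (C * th ^+ n * (2 / (1 + th)) ^+ n)).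
    by rewrite ler_wpM2r // exprn_ge0 // divr_ge0 //; lra.
  by rewrite -mulrA -exprMn /z mulrCA mulrA.
- exact: is_cvg_geometric_series.
Qed.

End Shift.
Arguments sh {R} a j.
Arguments lag {R} mu j.

Lemma is_derive_eq0 (R : realType) (f : R -> R) x y d :
  (forall z, 0 < z -> z < y -> f z = 0) -> 0 < x -> x < y ->
  is_derive x 1 f d -> d = 0.
Proof.
move=> f0 x0 xy [_ <-]; rewrite (@near_eq_derive _ _ _ f (cst 0)); first exact: derive_cst.
near=> z; rewrite f0 //; near: z; [exact: lt_nbhsr|exact: lt_nbhsl].
Unshelve. all: by end_near. Qed.

(** * The quadratic equation and the branch that F follows *)

Section FixedPoint.
Variables (R : realType) (q : R) (mu a : nat -> R).
Hypothesis q_ge0 : 0 <= q.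
Hypothesis q_lt1 : q < 1.
Hypothesis mu_ge0 : forall j, 0 <= mu j.
Hypothesis a_ge0 : forall j, 0 <= a j.
(** Lack of memory of the geometric law: with probability 1 - q the root has no child; otherwise the
    first child sends (X' - 1)_+ cars, and what the root receives besides is an independent copy of
    X. *)
Hypothesis a_fix : forall j, a j = (1 - q) * mu j + q * cprod (sh a) a j.
Implicit Types (x y : R).

Let c := q * a 0%N.
Definition ell x := x - c * (x - 1).
(* [bra] is the square root, with its sign, of the discriminant of the quadratic
   equation satisfied by [gf a]: it is positive on the larger branch. *)
Definition bra x := 2 * q * gf a x - ell x.
Let F := gf a.
Let H := gf (lag mu).

(** The coefficients of a dominate those of (1 - q) mu. *)
Lemma fix_cvg_mu x : 0 <= x -> cvgn (pseries a x) -> cvgn (pseries mu x).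
Proof.
move=> x0 ca; have p : 0 < 1 - q by rewrite subr_gt0.
apply: (@pseries_bounded_cvg _ _ _ (F x / (1 - q))) => // n.
rewrite ler_pdivlMr // mulrC -pseriesZ.
apply: le_trans (pseries_le_gf _ a x n a_ge0 x0 ca).
rewrite !pseriesE ler_sum // => i _; rewrite ler_wpM2r ?exprn_ge0 //.
rewrite [leRHS]a_fix lerDl mulr_ge0 // cprod_ge0 //; exact: sh_ge0.
Qed.

Lemma fix_gf x : 0 <= x -> cvgn (pseries a x) ->
  F x = (1 - q) * gf mu x + q * (gf (sh a) x * F x).
Proof.
move=> x0 ca; have cm := fix_cvg_mu x x0 ca; have cs := cvg_sh _ a x ca.
have s0 := sh_ge0 _ a a_ge0.
have := gf_fix _ (fun j => (1 - q) * mu j) (fun j => q * sh a j) a x.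
rewrite !gfZ // -mulrA; apply=> //; try exact: is_cvg_pseriesZ.
  by move=> j; rewrite mulr_ge0.
move=> j; rewrite {1}a_fix /cprod mulr_sumr; congr (_ + _).
by apply: eq_bigr => i _; rewrite mulrA.
Qed.

Lemma fix_quadratic x : 0 <= x -> cvgn (pseries a x) ->
  q * F x ^+ 2 - ell x * F x + (1 - q) * H x = 0.
Proof.
move=> x0 ca; have E := fix_gf x x0 ca; have S := gf_sh _ a x ca.
rewrite /H gf_lag; last exact: fix_cvg_mu.
have : x * F x = (1 - q) * (x * gf mu x) + q * (a 0%N * (x - 1) + F x) * F x.
  by rewrite -/F in S; rewrite -S {1}E; ring.
by move=> E2; rewrite /ell /c; lra.
Qed.

Lemma bra_sqr x : 0 <= x -> cvgn (pseries a x) ->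
  bra x ^+ 2 = ell x ^+ 2 - 4 * q * (1 - q) * H x.
Proof.
move=> x0 ca; have := fix_quadratic x x0 ca; rewrite /bra -/F => E.
have E4 : q * (q * F x ^+ 2 - ell x * F x + (1 - q) * H x) = 0 by rewrite E mulr0.
by lra.
Qed.

(* The tails [w n = sum_(i >= n) a i * x ^+ i] satisfy
   [(ell x - q * F x) * w n >= q * (a 0 * w n.+1 + (F x - w n - a 0) * w n)],
   so they decay geometrically as soon as [2 * q * F x > ell x]. *)
Lemma bra_gt0_extension x : 0 < x -> cvgn (pseries a x) -> 0 < bra x ->
  exists2 y, x < y & cvgn (pseries a y).
Proof.
move=> x0 ca P0; have x0' := ltW x0; have cm := fix_cvg_mu x x0' ca.
pose w n := F x - pseries a x n; pose p := bra x.
have w_ge0 n : 0 <= w n by rewrite subr_ge0 pseries_le_gf.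
have wS n : w n = a n * x ^+ n + w n.+1 by rewrite /w pseriesS; ring.
have w_le n m : (n <= m)%N -> w m <= w n.
  by move=> nm; rewrite lerB // pseries_nondecreasing.
have s0 := sh_ge0 _ a a_ge0.
have key n : (p - q * w n.+1) * w n.+1 <= q * a 0%N * (w n.+1 - w n.+2).
  have E0 := fix_gf x x0' ca.
  have E1 : pseries a x n.+1 = (1 - q) * pseries mu x n.+1
      + q * pseries (cprod a (sh a)) x n.+1.
    rewrite -!pseriesZ -pseriesD; congr (pseries _ x n.+1).
    by apply/funext => j; rewrite cprodC; exact: a_fix.
  have S := gf_sh _ a x ca; rewrite -/F in S.
  have Sp m : x * pseries (sh a) x m.+1 = x * gf (sh a) x - w m.+2.
    by rewrite pseries_sh S /w; ring.
  (* In the Cauchy product the term i = 0 misses the tail [w n.+2], and a term i >= 1 misses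
     [w (n.+2 - i)], which is at least [w n.+1]. *)
  have E2 : x * pseries (cprod a (sh a)) x n.+1 <=
      x * gf (sh a) x * pseries a x n.+1
      - (a 0%N * w n.+2 + (pseries a x n.+1 - a 0%N) * w n.+1).
    rewrite pseries_cprod mulr_sumr big_ord_recl /= expr0 mulr1 subn0.
    rewrite mulrCA Sp pseriesS_l mulrDr.
    have -> : a 0%N + \sum_(i < n) a i.+1 * x ^+ i.+1 - a 0%N =
      \sum_(i < n) a i.+1 * x ^+ i.+1 by rewrite addrC addKr.
    have : \sum_(i < n) x * (a i.+1 * x ^+ i.+1 * pseries (sh a) x (n.+1 - i.+1)%N)
      <= (x * gf (sh a) x - w n.+1) * \sum_(i < n) a i.+1 * x ^+ i.+1.
      rewrite mulr_sumr ler_sum // => i _.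
      rewrite mulrCA mulrC ler_wpM2r ?mulr_ge0 ?exprn_ge0 //.
      rewrite subSS -(@prednK (n - i)) ?subn_gt0 // Sp lerB // w_le //.
      by rewrite prednK ?subn_gt0 // ltnS leq_subr.
    rewrite /bump /=; lra.
  have E3 : pseries mu x n.+1 <= gf mu x by rewrite pseries_le_gf.
  have E4 : x * pseries a x n.+1 <= x * (1 - q) * gf mu x
      + q * (x * gf (sh a) x * pseries a x n.+1
      - (a 0%N * w n.+2 + (pseries a x n.+1 - a 0%N) * w n.+1)).
    rewrite E1 mulrDr; apply: lerD.
      by rewrite mulrA ler_wpM2l // mulr_ge0 // subr_ge0 ltW.
    by rewrite mulrCA -E1 ler_wpM2l.
  have E5 : x * F x = x * (1 - q) * gf mu x + q * (x * gf (sh a) x * F x).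
    by rewrite {1}E0; ring.
  have wE : pseries a x n.+1 = F x - w n.+1 by rewrite /w; ring.
  move: E4 E5; rewrite S wE /p /bra /ell /c -/F; move=> E4 E5.
  lra.
(* From N on the quadratic term of [key] uses up at most half of p. *)
have [N HN] : exists N, forall n, (N <= n)%N -> q * w n.+1 <= p / 2.
  have /cvgrPdist_le/(_ (p / 2)) := ca; rewrite divr_gt0 // => /(_ isT)[N _ HN].
  exists N => n Nn; have := HN n.+1 (leqW Nn); rewrite /= -/(gf a x) -/F -/(w _).
  rewrite ger0_norm // => wp; apply: le_trans wp.
  by rewrite ler_piMl // ltW.
(* The ratio comes from p / 2 * w n.+1 <= (q a 0 + p) (w n.+1 - w n.+2); enlarging q a 0 by p keeps
   th positive. *)
pose th := 1 - p / (2 * (q * a 0%N + p)).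
have D0 : 0 < q * a 0%N + p by rewrite ltr_wpDl // mulr_ge0.
have thE : 1 - th = p / (2 * (q * a 0%N + p)) by rewrite /th; ring.
have th1 : th < 1 by rewrite -subr_gt0 thE divr_gt0 // mulr_gt0.
have th0 : 0 < th.
  rewrite /th subr_gt0 ltr_pdivrMr ?mulr_gt0 // mul1r.
  have : 0 <= q * a 0%N by rewrite mulr_ge0.
  lra.
have step n : (N <= n)%N -> w n.+2 <= th * w n.+1.
  move=> Nn; have k := key n; have h := HN n Nn; have w1 := w_ge0 n.+1.
  have w12 := w_le n.+1 n.+2 (leqnSn _).
  have k2 : p / 2 * w n.+1 <= (q * a 0%N + p) * (w n.+1 - w n.+2).
    apply: (@le_trans _ _ ((p - q * w n.+1) * w n.+1)); first by rewrite ler_wpM2r //; lra.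
    apply: le_trans k _; rewrite ler_wpM2r ?subr_ge0 // lerDl ltW //.
  have : (1 - th) * w n.+1 <= w n.+1 - w n.+2.
    rewrite thE -(ler_pM2l D0); apply: le_trans k2; rewrite le_eqVlt; apply/orP; left.
    by apply/eqP; field; rewrite gt_eqF.
  lra.
have dec m : w (N + m).+1 <= th ^+ m * w N.+1.
  elim: m => [|m IH]; first by rewrite addn0 expr0 mul1r.
  rewrite addnS exprS -mulrA; apply: le_trans (step _ (leq_addr m N)) _.
  by rewrite ler_wpM2l // ltW.
(* Dividing by th ^+ N.+1 covers the indices up to N.+1, where tails are only bounded by [w 0]. *)
pose C := w 0%N / th ^+ N.+1.
apply: (@geometric_extension _ a x th C) => // n.
apply: (@le_trans _ _ (w n)); first by rewrite wS lerDl.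
have tp k : 0 < th ^+ k by rewrite exprn_gt0.
rewrite /C mulrAC ler_pdivlMr //.
have [nN|Nn] := leqP n N.+1.
  apply: ler_pM => //; first exact: ltW.
    exact: w_le.
  by apply: ler_wiXn2l => //; exact: ltW.
rewrite -(subnKC Nn) addSn addSn; set m := (n - N.+2)%N.
apply: (@le_trans _ _ (th ^+ m.+1 * w N.+1 * th ^+ N.+1)).
  apply: ler_wpM2r; first exact: ltW.
  by have := dec m.+1; rewrite addnS.
have -> : (N + m).+2 = (m.+1 + N.+1)%N by rewrite addSn addnS addnC.
by rewrite exprD mulrA ler_pM2r // mulrC ler_pM2r // w_le.
Qed.

Let F1 := gf (pseries_diffs a).
Let F2 := gf (pseries_diffs (pseries_diffs a)).
Let H1 := gf (pseries_diffs (lag mu)).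
Let H2 := gf (pseries_diffs (pseries_diffs (lag mu))).
Let lag0 : forall j, 0 <= lag mu j. Proof. exact: lag_ge0. Qed.

Lemma fix_derive1 x y : 0 < x -> x < y -> cvgn (pseries a y) ->
  bra x * F1 x = (1 - c) * F x - (1 - q) * H1 x.
Proof.
move=> x0 xy ca; have x0' := ltW x0; have y0 := le_trans x0' (ltW xy).
have dF := gf_is_derive _ a x y a_ge0 x0' xy ca.
have dH := gf_is_derive _ _ x y lag0 x0' xy (cvg_lag _ _ _ (fix_cvg_mu y y0 ca)).
pose f z := q * F z ^+ 2 - (z - c * (z - 1)) * F z + (1 - q) * H z.
have df : is_derive x 1 f (2 * q * F x * F1 x - (1 - c) * F x
    - (x - c * (x - 1)) * F1 x + (1 - q) * H1 x).
  rewrite /f /F /H; apply: is_derive_eq.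
  by rewrite /GRing.scale /= /F1 /H1; ring.
have f0 z : 0 < z -> z < y -> f z = 0.
  move=> z0 zy; rewrite /f -/(ell z) fix_quadratic //; first exact: ltW.
  by apply: pseries_cvg_le (ltW zy) ca => //; exact: ltW.
have := is_derive_eq0 _ f x y _ f0 x0 xy df.
by rewrite /bra /ell -/F; lra.
Qed.

Lemma fix_derive2 x y : 0 < x -> x < y -> cvgn (pseries a y) ->
  bra x * F2 x + 2 * q * F1 x ^+ 2 - 2 * (1 - c) * F1 x + (1 - q) * H2 x = 0.
Proof.
move=> x0 xy ca; have x0' := ltW x0; have y0 := le_trans x0' (ltW xy).
have xm : x < (x + y) / 2 by lra.
have my : (x + y) / 2 < y by lra.
have m0 : 0 <= (x + y) / 2 by lra.
have cl := cvg_lag _ _ _ (fix_cvg_mu y y0 ca).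
have dF := gf_is_derive _ a x y a_ge0 x0' xy ca.
have dF1 := gf_is_derive _ _ x _ (pseries_diffs_ge0 _ _ a_ge0) x0' xm
  (cvg_pseries_diffs _ _ _ _ a_ge0 m0 my ca).
have dH1 := gf_is_derive _ _ x _ (pseries_diffs_ge0 _ _ lag0) x0' xm
  (cvg_pseries_diffs _ _ _ _ lag0 m0 my cl).
pose f z := (2 * q * F z - (z - c * (z - 1))) * F1 z - (1 - c) * F z + (1 - q) * H1 z.
have df : is_derive x 1 f ((2 * q * F1 x - (1 - c)) * F1 x
    + (2 * q * F x - (x - c * (x - 1))) * F2 x - (1 - c) * F1 x + (1 - q) * H2 x).
  rewrite /f /F /F1 /H1; apply: is_derive_eq.
  by rewrite /GRing.scale /= /F2 /H2; ring.
have f0 z : 0 < z -> z < y -> f z = 0.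
  by move=> z0 zy; rewrite /f -/(ell z) -/(bra z) (fix_derive1 z y) //; ring.
have := is_derive_eq0 _ f x y _ f0 x0 xy df.
by rewrite /bra /ell -/F; lra.
Qed.

Hypothesis mu_nontrivial : exists2 j, (2 <= j)%N & 0 < mu j.

Let lag_nontrivial : exists2 j, (3 <= j)%N & 0 < lag mu j.
Proof. by case: mu_nontrivial => j j2 muj; exists j.+1. Qed.

Lemma fix_ge j : (1 - q) * mu j <= a j.
Proof. by rewrite [leRHS]a_fix lerDl mulr_ge0 // cprod_ge0 //; exact: sh_ge0. Qed.

Lemma fix_gt0 j : 0 < mu j -> 0 < a j.
Proof. by move=> muj; apply: lt_le_trans (fix_ge j); rewrite mulr_gt0 // subr_gt0. Qed.

(* Differentiating the quadratic equation twice, the assumption [inflex >= 0]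
   turns the expression of [F''] into minus a square. *)
Lemma bra_le0_of_inflex t x : cvg_order2 _ (lag mu) t -> inflex _ (lag mu) t = 0 ->
  0 < t -> t <= x -> cvgn (pseries a x) -> bra x <= 0.
Proof.
move=> ct it t0 tx cx; rewrite leNgt; apply/negP => P0.
have x0 := lt_le_trans t0 tx; have x0' := ltW x0.
have [y xy ca] := bra_gt0_extension x x0 cx P0.
have y0 : 0 <= y by exact: le_trans (ltW xy).
have cl := cvg_lag _ _ _ (fix_cvg_mu y y0 ca).
have D0 : 0 <= inflex _ (lag mu) x.
  move: tx; rewrite le_eqVlt => /predU1P[<-|tx]; first by rewrite it.
  rewrite -it ltW //; apply: inflex_lt => //; first exact: ltW.
  exact: cvg_order2_lt xy cl.
have e0 := fix_quadratic x x0' cx.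
have e1 := fix_derive1 x y x0 xy ca.
have e2 := fix_derive2 x y x0 xy ca.
have [j j2 muj] := mu_nontrivial.
have Hp : 0 < H x.
  apply: (gf_gt0 _ _ x j.+1) => //.
  by apply: cvg_lag; exact: fix_cvg_mu.
have F2p : 0 < F2 x.
  case: j j2 muj => [|[|j]] // _ muj; apply: (gf_gt0 _ _ x j) => //.
  - by do 2 apply: pseries_diffs_ge0.
  - by rewrite /pseries_diffs !mulr_gt0 ?ltr0n // fix_gt0.
  - by have [] := cvg_order2_lt _ _ a_ge0 _ _ x0' xy ca.
have q1 : 0 < 1 - q by rewrite subr_gt0.
have Kp : 0 < F x * (ell x - q * F x).
  by rewrite (_ : _ * _ = (1 - q) * H x) ?mulr_gt0 //; lra.
have ineq : 2 * ((1 - q) * H x) * ((1 - q) * H2 x) - ((1 - q) * H1 x) ^+ 2 >= 0.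
  rewrite (_ : _ - _ = (1 - q) ^+ 2 * inflex _ (lag mu) x).
    by rewrite mulr_ge0 // exprn_ge0 // ltW.
  by rewrite /inflex -/H -/H1 -/H2; ring.
have h0 : (1 - q) * H x = F x * (ell x - q * F x) by lra.
have h1 : (1 - q) * H1 x = (1 - c) * F x - bra x * F1 x by lra.
have h2 : (1 - q) * H2 x = - (bra x * F2 x + 2 * q * F1 x ^+ 2 - 2 * (1 - c) * F1 x) by lra.
(* Put K = F (ell - q F) = (1 - q) H. Then [ineq] reads - 2 K bra F2 - (ell F1 - (1 - c) F)^2 >= 0,
   although K, bra and F2 are positive. *)
have sqr : 2 * (F x * (ell x - q * F x)) * (2 * q * F1 x ^+ 2 - 2 * (1 - c) * F1 x)
    + ((1 - c) * F x - bra x * F1 x) ^+ 2 = (ell x * F1 x - (1 - c) * F x) ^+ 2.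
  by rewrite /bra -/F; ring.
have sqr0 : 0 <= (ell x * F1 x - (1 - c) * F x) ^+ 2 by exact: sqr_ge0.
have KP : 0 < F x * (ell x - q * F x) * (bra x * F2 x).
  by apply: mulr_gt0 Kp _; exact: mulr_gt0.
move: ineq; rewrite h0 h1 h2; lra.
Qed.

(** At a zero of [bra] the line [ell], of slope 1 - c, touches sqrt (4 q (1 - q) H). The two
    equations have the form required by [tangent_above]. *)
Lemma bra_eq0_tangent x y : 0 < x -> x < y -> cvgn (pseries a y) -> bra x = 0 ->
  ell x ^+ 2 = 4 * q * (1 - q) * H x /\
  4 * q * (1 - q) * H1 x = 2 * (ell x * (1 - c)).
Proof.
move=> x0 xy ca P0; have cx : cvgn (pseries a x).
  by apply: pseries_cvg_le (ltW xy) ca => //; exact: ltW.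
have := bra_sqr x (ltW x0) cx; have := fix_derive1 x y x0 xy ca.
rewrite P0 mul0r expr0n /= => e1 e0; split; first by lra.
have -> : 4 * q * (1 - q) * H1 x = 4 * q * ((1 - q) * H1 x) by ring.
have -> : (1 - q) * H1 x = (1 - c) * F x by lra.
have -> : ell x = 2 * q * F x by move: P0; rewrite /bra -/F; lra.
ring.
Qed.

Lemma bra_continuous x t : 0 <= x -> cvgn (pseries a t) ->
  {within `[x, t], continuous bra}.
Proof.
move=> x0 ca; apply/subspace_continuousP => z zin.
have g := gf_cvg_within _ a x t z a_ge0 x0 ca zin.
apply: cvgB; first exact: cvgMr.
have zz : z @[z --> within `[x, t] (nbhs z)] --> z by exact: cvg_within.
by apply: cvgB => //; apply: cvgMr; apply: cvgB => //; exact: cvg_cst.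
Qed.

End FixedPoint.

(** * The law of the number of visits *)

Lemma cvg_sum_ord (R : realType) (T : Type) (G : set_system T) (FG : Filter G)
    n (f : 'I_n -> T -> R) (l : 'I_n -> R) :
  (forall i, f i x @[x --> G] --> l i) ->
  \sum_i f i x @[x --> G] --> \sum_i l i.
Proof.
elim: n f l => [|n IH] f l fl.
  rewrite big_ord0; under eq_fun do rewrite big_ord0; exact: cvg_cst.
rewrite big_ord_recl; under eq_fun do rewrite big_ord_recl.
by apply: cvgD => //; apply: IH => i; exact: fl.
Qed.

(** * Convolution equations a = nu + y * a and their comparison *)

Section Resolvent.
Variable R : realType.
Implicit Types (nu y a b D : nat -> R).

(** Each coefficient of nu / (1 - y) depends on all earlier ones, so the recursion carries their
    list. *)
Fixpoint res_seq nu y n : seq R :=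
  if n is m.+1 then
    let s := res_seq nu y m in
    rcons s ((nu m + \sum_(i < m) s`_i * y (m - i)%N) / (1 - y 0%N))
  else [::].

Definition res nu y n := (res_seq nu y n.+1)`_n.

Lemma size_res_seq nu y n : size (res_seq nu y n) = n.
Proof. by elim: n => //= n IH; rewrite size_rcons IH. Qed.

Lemma nth_res_seq nu y n i : (i < n)%N -> (res_seq nu y n)`_i = res nu y i.
Proof.
elim: n => // n IH; rewrite ltnS leq_eqVlt => /predU1P[->//|i_n].
by rewrite /= nth_rcons size_res_seq i_n IH.
Qed.

Lemma resE nu y n : res nu y n =
  (nu n + \sum_(i < n) res nu y i * y (n - i)%N) / (1 - y 0%N).
Proof.
rewrite {1}/res /= nth_rcons size_res_seq ltnn eqxx.
by under eq_bigr => i _ do rewrite nth_res_seq //.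
Qed.

Lemma res_fix nu y n : y 0%N < 1 -> res nu y n = nu n + cprod y (res nu y) n.
Proof.
move=> y1; rewrite cprodC /cprod big_ord_recr /= subnn addrA.
have p : 1 - y 0%N != 0 by rewrite gt_eqF // subr_gt0.
have := resE nu y n => /(congr1 (fun z => z * (1 - y 0%N))).
by rewrite mulfVK // mulrBr mulr1 => <-; rewrite subrK.
Qed.

Lemma res_ge0 nu y : (forall j, 0 <= nu j) -> (forall j, 0 <= y j) ->
  y 0%N < 1 -> forall n, 0 <= res nu y n.
Proof.
move=> nu0 y0 y1 n; have [k] := ubnP n; elim: k n => // k IH n nk.
rewrite resE divr_ge0 //; last by rewrite subr_ge0 ltW.
rewrite addr_ge0 // sumr_ge0 // => i _.
by rewrite mulr_ge0 // IH // (leq_trans (ltn_ord i)).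
Qed.

Lemma res_uniq nu y a : y 0%N < 1 -> (forall j, a j = nu j + cprod y a j) ->
  forall n, a n = res nu y n.
Proof.
move=> y1 ha n; have [k] := ubnP n; elim: k n => // k IH n nk.
rewrite resE; have p : 1 - y 0%N != 0 by rewrite gt_eqF // subr_gt0.
apply: (mulIf p); rewrite mulfVK // mulrBr mulr1 {1}ha cprodC /cprod.
rewrite big_ord_recr /= subnn addrA addrK; congr (_ + _).
by apply: eq_bigr => i _; rewrite IH // (leq_trans (ltn_ord i)).
Qed.

(** A partial sum p of a satisfies p <= N + h p, and p is finite. *)
Lemma fix_bound nu y a x N h : (forall j, 0 <= a j) -> (forall j, 0 <= y j) ->
  (forall j, a j = nu j + cprod y a j) -> 0 <= x ->
  (forall n, pseries nu x n <= N) -> (forall n, pseries y x n <= h) -> h < 1 ->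
  forall n, pseries a x n <= N / (1 - h).
Proof.
move=> a0 y0 ha x0 nuN yh h1 n; rewrite ler_pdivlMr ?subr_gt0 //.
rewrite mulrBr mulr1 lerBlDr.
have {1}-> : pseries a x n = pseries nu x n + pseries (cprod y a) x n.
  by rewrite -pseriesD; congr (pseries _ x n); apply/funext => j; exact: ha.
rewrite lerD //; apply: le_trans (pseries_cprod_le _ y a x n y0 a0 x0) _.
by rewrite mulrC ler_wpM2l // pseries_ge0.
Qed.

Definition cumul a n := \sum_(i < n.+1) a i.

Lemma cumul_pseries a n : cumul a n = pseries a 1 n.+1.
Proof. by rewrite pseriesE; apply: eq_bigr => i _; rewrite expr1n mulr1. Qed.

Lemma cumul_sh a n : cumul (sh a) n = cumul a n.+1.
Proof. by rewrite /cumul big_ord_recl [RHS]big_ord_recl big_ord_recl /= addrA. Qed.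

Lemma cumul_cprod b a n : cumul (cprod b a) n = \sum_(i < n.+1) b i * cumul a (n - i)%N.
Proof.
rewrite /cumul sum_cprod; apply: eq_bigr => i _.
by rewrite -subSn // -ltnS.
Qed.

(** Strong induction: the term i = 0 is absorbed by 1 - y 0 > 0, and the others involve earlier
    values of D. *)
Lemma renewal_ge0 y D : (forall j, 0 <= y j) -> y 0%N < 1 ->
  (forall n, \sum_(i < n.+1) y i * D (n - i)%N <= D n) -> forall n, 0 <= D n.
Proof.
move=> y0 y1 hD n; have [k] := ubnP n; elim: k n => // k IH n nk.
have := hD n; rewrite big_ord_recl /= subn0 -lerBrDl => h.
have : 0 <= (1 - y 0%N) * D n.
  rewrite mulrBl mul1r; apply: le_trans h; rewrite sumr_ge0 // => i _.
  apply: mulr_ge0 => //; apply: IH; rewrite /bump /= add1n.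
  apply: (@leq_trans n) => //; by rewrite ltn_subrL (leq_trans _ (ltn_ord i)).
by rewrite pmulr_rge0 // subr_gt0.
Qed.

(** For D = cumul a - cumul a', the difference D - y' * D is the cumulative sum of (y - y') * a,
    which is nonnegative once the sum is arranged along a; then [renewal_ge0] applies. *)
Lemma cumul_fix_le nu y y' a a' : (forall j, 0 <= a j) -> (forall j, 0 <= y' j) ->
  y' 0%N < 1 ->
  (forall j, a j = nu j + cprod y a j) -> (forall j, a' j = nu j + cprod y' a' j) ->
  (forall n, cumul y' n <= cumul y n) -> forall n, cumul a' n <= cumul a n.
Proof.
move=> a0 y0 y1 ha ha' hy n; rewrite -subr_ge0.
apply: (renewal_ge0 y' (fun n => cumul a n - cumul a' n)) => // {}n.
have E z w : (forall j, w j = nu j + cprod z w j) -> cumul w n = cumul nu n + cumul (cprod z w) n.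
  by move=> hw; rewrite /cumul -big_split /=; apply: eq_bigr => i _; rewrite hw.
rewrite (E _ _ ha) (E _ _ ha') cumul_cprod [X in _ - (_ + X)]cumul_cprod.
under eq_bigr do rewrite mulrBr; rewrite sumrB.
rewrite opprD addrACA subrr add0r lerD2r -!cumul_cprod.
have C b c : cumul (cprod b c) n = cumul (cprod c b) n.
  by apply: eq_bigr => i _; rewrite cprodC.
rewrite (C y' a) (C y a) !cumul_cprod ler_sum // => i _.
by rewrite ler_wpM2l.
Qed.

End Resolvent.
Arguments res {R} nu y n.
Arguments cumul {R} a n.

(** * Stochastic domination and exponential moments *)

Section Domination.
Variable R : realType.
Implicit Types (a b : nat -> R) (x : R).

Lemma pseries_tail_scale a x n m : (forall j, 0 <= a j) -> 1 <= x -> (n <= m)%N ->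
  x ^+ n * (pseries a 1 m - pseries a 1 n) <= pseries a x m - pseries a x n.
Proof.
move=> a0 x1 nm; rewrite /pseries !sub_series_geq //= mulr_sumr.
rewrite !big_nat ler_sum // => i /andP[ni _].
by rewrite expr1n mulr1 mulrC ler_wpM2l // ler_weXn2l.
Qed.

(** Markov's inequality in the form x^n P(X >= n) <= E[x^X; n <= X < oo], for total mass 1. *)
Lemma gf1_tail_le a x n : (forall j, 0 <= a j) -> 1 <= x ->
  cvgn (pseries a x) ->
  x ^+ n * (gf a 1 - pseries a 1 n) <= gf a x - pseries a x n.
Proof.
move=> a0 x1 ca; have c1 : cvgn (pseries a 1) by apply: pseries_cvg_le x1 ca.
have l1 : x ^+ n * (pseries a 1 (m + n)%N - pseries a 1 n) @[m --> \oo] -->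
    x ^+ n * (gf a 1 - pseries a 1 n).
  apply: cvgMr; apply: cvgB; last exact: cvg_cst.
  by rewrite (cvg_shiftn n (pseries a 1)).
have l2 : pseries a x (m + n)%N - pseries a x n @[m --> \oo] -->
    gf a x - pseries a x n.
  by apply: cvgB; [rewrite (cvg_shiftn n (pseries a x))|exact: cvg_cst].
apply: (cvgn_le _ _ _ _ _ l1 l2) => m; apply: pseries_tail_scale => //.
exact: leq_addl.
Qed.

(* Summation by parts writes a truncated moment as an increasing function of
   the tails [1 - cumul]. *)
Lemma pseries_cumul_le a b x n : (forall j, 0 <= b j) -> 1 <= x ->
  (forall j, cumul a j <= 1) -> (forall j, cumul b j <= cumul a j) ->
  cvgn (pseries b x) -> gf b 1 = 1 -> pseries a x n <= gf b x.
Proof.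
move=> b0 x1 a1 ba cb sb; have x0 : 0 <= x by exact: le_trans x1.
case: n => [|n]; first by rewrite pseriesE big_ord0; apply: gf_ge0.
(* This is E[x^min(X, n)], the missing mass being placed at infinity. *)
pose T c := pseries c x n.+1 + x ^+ n * (1 - cumul c n).
have TE c : T c = 1 + \sum_(i < n) (x ^+ i.+1 - x ^+ i) * (1 - cumul c i).
  rewrite /T {T}; elim: n => [|n IH].
    by rewrite pseriesE big_ord_recl !big_ord0 /cumul big_ord_recl big_ord0 /= expr0; ring.
  rewrite big_ord_recr /= addrA -IH pseriesS [cumul c n.+1]/cumul big_ord_recr /= -/(cumul c n).
  by ring.
apply: (@le_trans _ _ (T a)).
  by rewrite lerDl mulr_ge0 ?exprn_ge0 // subr_ge0.
apply: (@le_trans _ _ (T b)).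
  rewrite !TE lerD2l ler_sum // => i _; rewrite ler_wpM2l ?lerB //.
  by rewrite subr_ge0 ler_weXn2l.
(* Since b has mass 1, the remainder in [T b] is bounded by the actual tail of its series at x. *)
have h := gf1_tail_le b x n.+1 b0 x1 cb; rewrite sb in h.
rewrite -lerBrDl cumul_pseries; apply: le_trans h.
have p1 : pseries b 1 n.+1 <= 1.
  by rewrite -[leRHS]sb pseries_le_gf //; exact: pseries_cvg_le x1 cb.
by rewrite ler_wpM2r ?subr_ge0 // ler_weXn2l.
Qed.

End Domination.

(** * The laws of X_n and their limit *)

Section Laws.
Variables (R : realType) (mu : nat -> R).
Hypothesis mu_ge0 : forall j, 0 <= mu j.
Hypothesis mu_cvg : cvgn (pseries mu 1).
Hypothesis mu_sum : gf mu 1 = 1.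
Implicit Types (q x : R) (n j : nat).

(* [law q n.+1] is the law of the number of visits at the root of the tree cut
   at height [n]; [law q 0] stands for an empty tree. *)
Fixpoint law q n : nat -> R :=
  if n is m.+1 then
    res (fun j => (1 - q) * mu j) (fun j => q * sh (law q m) j)
  else fun j => (j == 0%N)%:R.

Section FixedParameter.
Variable q : R.
Hypotheses (q_ge0 : 0 <= q) (q_lt1 : q < 1).

Let law_dist n : [/\ forall j, 0 <= law q n j, cvgn (pseries (law q n) 1) &
  gf (law q n) 1 = 1].
Proof.
elim: n => [|n [l0 lc l1]].
  have c0 : pseries (law q 0) 1 @ \oo --> (1 : R).
    apply: cvg_near_cst; exists 1%N => // -[//|n] _.
    by rewrite pseriesS_l /= big1 ?addr0 // => i _; rewrite mul0r.
  split; first by move=> j; rewrite ler0n.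
    by apply/cvg_ex; exists 1.
  exact: (cvg_lim _ c0).
have s0 := sh_ge0 _ _ l0; have sc := cvg_sh _ _ _ lc.
have s1 : gf (sh (law q n)) 1 = 1.
  by have := gf_sh _ _ _ lc; rewrite mul1r subrr mulr0 add0r l1.
have y0 j : 0 <= q * sh (law q n) j by rewrite mulr_ge0.
have y1 : q * sh (law q n) 0%N < 1.
  apply: le_lt_trans q_lt1; rewrite ler_piMr // -s1.
  by have := term_le_gf _ _ 1 0 s0 ler01 sc; rewrite expr0 mulr1.
have nu0 j : 0 <= (1 - q) * mu j by rewrite mulr_ge0 // subr_ge0 ltW.
have w0 := res_ge0 _ _ _ nu0 y0 y1.
have wf j := res_fix _ (fun j => (1 - q) * mu j) (fun j => q * sh (law q n) j) j y1.
have bnd m : pseries (law q n.+1) 1 m <= (1 - q) / (1 - q).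
  apply: (fix_bound _ _ _ _ _ _ _ w0 y0 wf ler01 _ _ q_lt1) => k.
    rewrite pseriesZ ler_piMr ?subr_ge0 //; first exact: ltW.
    by rewrite -[leRHS]mu_sum pseries_le_gf.
  rewrite pseriesZ ler_piMr //.
  by rewrite -[leRHS]s1 pseries_le_gf.
have wc : cvgn (pseries (law q n.+1) 1) by apply: pseries_bounded_cvg bnd.
split => //.
have := gf_fix _ _ _ _ 1 y0 w0 wf ler01 (is_cvg_pseriesZ _ _ _ _ mu_cvg)
  (is_cvg_pseriesZ _ _ _ _ sc) wc.
rewrite !gfZ // mu_sum s1 -/(law q n.+1) => E.
have q1 : 1 - q != 0 by rewrite gt_eqF // subr_gt0.
by apply: (mulfI q1); lra.
Qed.

Lemma law_ge0 n j : 0 <= law q n j. Proof. by case: (law_dist n). Qed.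
Lemma law_cvg n : cvgn (pseries (law q n) 1). Proof. by case: (law_dist n). Qed.
Lemma law_sum n : gf (law q n) 1 = 1. Proof. by case: (law_dist n). Qed.

Lemma cumul_law_le1 n j : cumul (law q n) j <= 1.
Proof.
rewrite -[leRHS](law_sum n) cumul_pseries; apply: pseries_le_gf => //.
  exact: law_ge0.
exact: law_cvg.
Qed.

Lemma law_input_lt1 n : q * sh (law q n) 0%N < 1.
Proof.
apply: le_lt_trans q_lt1; rewrite ler_piMr //.
by have := cumul_law_le1 n 1; rewrite /cumul big_ord_recr big_ord1.
Qed.

Lemma law_input_ge0 n j : 0 <= q * sh (law q n) j.
Proof. by rewrite mulr_ge0 // sh_ge0 // => i; exact: law_ge0. Qed.

Lemma law_fix n j : law q n.+1 j =
  (1 - q) * mu j + cprod (fun i => q * sh (law q n) i) (law q n.+1) j.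
Proof. by rewrite /= res_fix //; exact: law_input_lt1. Qed.

(** Deeper trees bring more cars. In law this is [cumul_fix_le], iterated from the point mass at 0,
    whose cumulative sums are all 1. *)
Lemma cumul_law_S n j : cumul (law q n.+1) j <= cumul (law q n) j.
Proof.
elim: n j => [|n IH] j.
  rewrite (_ : cumul (law q 0) j = 1) ?cumul_law_le1 //.
  by rewrite /cumul big_ord_recl /= big1 ?addr0.
apply: (cumul_fix_le _ _ (fun i => q * sh (law q n) i)
   (fun i => q * sh (law q n.+1) i) _ _ (law_ge0 n.+1) (law_input_ge0 n.+1)
   (law_input_lt1 n.+1) (law_fix n) (law_fix n.+1)) => k.
have E b : cumul (fun i => q * sh b i) k = q * cumul b k.+1.
  by rewrite -cumul_sh /cumul mulr_sumr.
by rewrite !E ler_wpM2l.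
Qed.

Lemma cumul_law_le n m j : (n <= m)%N -> cumul (law q m) j <= cumul (law q n) j.
Proof.
move=> nm; have /nonincreasing_seqP := cumul_law_S ^~ j; exact.
Qed.

(** The law of X restricted to X < oo: mass may escape to infinity, so the total mass can be less
    than 1. *)
Definition lawlim j : R := limn (law q ^~ j).

Let cumul_law_cvg j : cvgn (fun n => cumul (law q n) j).
Proof.
apply: nonincreasing_is_cvgn; first by move=> n m nm; exact: cumul_law_le.
by exists 0 => _ [n _ <-]; rewrite sumr_ge0 // => i _; exact: law_ge0.
Qed.

Lemma law_cvg_lim j : law q ^~ j @ \oo --> lawlim j.
Proof.
rewrite /lawlim; case: j => [|j].
  by have := cumul_law_cvg 0; under eq_fun do rewrite /cumul big_ord1.
have E : (fun n => law q n j.+1) = (fun n => cumul (law q n) j.+1 - cumul (law q n) j).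
  by apply/funext => n; rewrite /cumul big_ord_recr /= addrAC subrr add0r.
by rewrite E; apply: is_cvgB.
Qed.

Lemma lawlim_ge0 j : 0 <= lawlim j.
Proof.
apply: limr_ge; first exact: law_cvg_lim.
by apply: nearW => n; exact: law_ge0.
Qed.

Lemma pseries_lawlim x m :
  pseries (law q n) x m @[n --> \oo] --> pseries lawlim x m.
Proof.
elim: m => [|m IH].
  rewrite [X in _ --> X]pseriesE big_ord0.
  under eq_fun do rewrite pseriesE big_ord0; exact: cvg_cst.
rewrite [X in _ --> X]pseriesS; under eq_fun do rewrite pseriesS.
by apply: cvgD => //; apply: cvgMl; exact: law_cvg_lim.
Qed.

Lemma cumul_lawlim j : cumul (law q n) j @[n --> \oo] --> cumul lawlim j.
Proof.
rewrite cumul_pseries; under eq_fun do rewrite cumul_pseries; exact: pseries_lawlim.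
Qed.

Lemma cumul_lawlim_le n j : cumul lawlim j <= cumul (law q n) j.
Proof.
have := cumul_lawlim j; rewrite -(cvg_shiftn n) => cl.
apply: (cvgn_le _ _ _ _ _ cl (cvg_cst _)) => m /=.
by apply: cumul_law_le; exact: leq_addl.
Qed.

Lemma lawlim_fix j : lawlim j = (1 - q) * mu j + q * cprod (sh lawlim) lawlim j.
Proof.
apply: (cvgn_eq _ (fun n => law q n.+1 j)).
  by rewrite (cvg_shiftS (law q ^~ j)); exact: law_cvg_lim.
have S i : sh (law q n) i @[n --> \oo] --> sh lawlim i.
  case: i => [|i] /=; last exact: law_cvg_lim.
  by apply: cvgD; exact: law_cvg_lim.
under eq_fun do rewrite law_fix.
apply: cvgD; first exact: cvg_cst.
rewrite /cprod mulr_sumr.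
apply: cvg_sum_ord => i; rewrite mulrA; apply: cvgM; first by apply: cvgMr; exact: S.
by rewrite (cvg_shiftS (law q ^~ _)); exact: law_cvg_lim.
Qed.

Lemma lawlim_cvg1 : cvgn (pseries lawlim 1).
Proof.
apply: (@pseries_bounded_cvg _ _ _ 1) => //; first exact: lawlim_ge0.
case=> [|n]; first by rewrite pseriesE big_ord0.
by rewrite -cumul_pseries; apply: le_trans (cumul_lawlim_le 0 n) (cumul_law_le1 0 n).
Qed.

Lemma lawlim0_le1 : lawlim 0%N <= 1.
Proof.
by have := le_trans (cumul_lawlim_le 0 0) (cumul_law_le1 0 0); rewrite /cumul big_ord1.
Qed.

(** The recursion [law_gf_step] as a bound on partial sums, so that finiteness of a moment passes
    from one height to the next. *)
Lemma law_bound_step n x M : 0 < x -> cvgn (pseries mu x) ->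
  (forall k, pseries (law q n) x k <= M) ->
  0 < x - q * law q n 0 * (x - 1) - q * M ->
  forall k, pseries (law q n.+1) x k <=
    (1 - q) * (x * gf mu x) / (x - q * law q n 0 * (x - 1) - q * M).
Proof.
move=> x0 cm bM D0 k.
pose h := q * ((law q n 0 * (x - 1) + M) / x).
have h1 : 1 - h = (x - q * law q n 0 * (x - 1) - q * M) / x.
  by rewrite /h; field; rewrite gt_eqF.
have h1p : 0 < 1 - h by rewrite h1 divr_gt0.
have -> : (1 - q) * (x * gf mu x) / (x - q * law q n 0 * (x - 1) - q * M) =
    (1 - q) * gf mu x / (1 - h).
  by rewrite h1; field; rewrite !gt_eqF.
apply: (fix_bound _ _ _ _ _ _ _ (law_ge0 n.+1) (law_input_ge0 n) (law_fix n) (ltW x0)).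
- move=> m; rewrite pseriesZ ler_wpM2l //; first by rewrite subr_ge0 ltW.
  by apply: pseries_le_gf => //; exact: ltW.
- move=> m; rewrite pseriesZ ler_wpM2l //.
  apply: (@le_trans _ _ (pseries (sh (law q n)) x m.+1)).
    apply: pseries_nondecreasing => //; last exact: ltW.
    by apply: sh_ge0 => i; exact: law_ge0.
  by rewrite ler_pdivlMr // mulrC pseries_sh lerD2l.
- by rewrite -subr_gt0.
Qed.

Lemma law_gf_step n x : 0 < x -> cvgn (pseries mu x) ->
  cvgn (pseries (law q n) x) -> cvgn (pseries (law q n.+1) x) ->
  (x - q * law q n 0 * (x - 1) - q * gf (law q n) x) * gf (law q n.+1) x =
  (1 - q) * (x * gf mu x).
Proof.
move=> x0 cm cn cS; have x0' := ltW x0.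
have cs := cvg_sh _ _ _ cn.
have ys := gf_sh _ _ _ cn.
have := gf_fix _ _ _ _ x (law_input_ge0 n) (law_ge0 n.+1) (law_fix n) x0'
  (is_cvg_pseriesZ _ _ _ _ cm) (is_cvg_pseriesZ _ _ _ _ cs) cS.
rewrite !gfZ // => E.
have : x * gf (law q n.+1) x = (1 - q) * (x * gf mu x)
   + q * (x * gf (sh (law q n)) x) * gf (law q n.+1) x by rewrite {1}E; ring.
rewrite ys; lra.
Qed.

End FixedParameter.

(** Each coefficient is a finite expression in s and earlier coefficients, with denominator 1 - s *
    sh (law s n) 0 > 0; the induction runs over n, then j. *)
Lemma law_continuous n j q : 0 <= q -> q < 1 -> {for q, continuous (fun s : R => law s n j)}.
Proof.
move=> q0 q1; elim: n j => [|n IH] j; first exact: cvg_cst.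
have S i : {for q, continuous (fun s : R => s * sh (law s n) i)}.
  apply: cvgM; first exact: cvg_id.
  by case: i => [|i]; [apply: cvgD; exact: IH|exact: IH].
have [k] := ubnP j; elim: k j => // k IHk j jk.
rewrite (_ : (fun s : R => law s n.+1 j) = (fun s : R => ((1 - s) * mu j
   + \sum_(i < j) law s n.+1 i * (s * sh (law s n) (j - i)%N)) / (1 - s * sh (law s n) 0%N))); last first.
  by apply/funext => s; rewrite /= resE.
apply: cvgM.
  apply: cvgD.
    by apply: cvgMl; apply: cvgB; [exact: cvg_cst|exact: cvg_id].
  apply: cvg_sum_ord => i; apply: cvgM; last exact: S.
  by apply: IHk; rewrite (leq_trans (ltn_ord i)).
apply: cvgV; first by rewrite gt_eqF // subr_gt0 law_input_lt1.
by apply: cvgB; [exact: cvg_cst|exact: S].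
Qed.

Lemma pseries_law_continuous n x m q : 0 <= q -> q < 1 ->
  {for q, continuous (fun s : R => pseries (law s n) x m)}.
Proof.
move=> q0 q1; elim: m => [|m IH].
  rewrite (_ : (fun _ => _) = cst 0); first exact: cvg_cst.
  by apply/funext => s; rewrite pseriesE big_ord0.
rewrite (_ : (fun _ => _) = (fun s : R => pseries (law s n) x m + law s n m * x ^+ m)).
  by apply: cvgD => //; apply: cvgMl; exact: law_continuous.
by apply/funext => s; rewrite pseriesS.
Qed.

End Laws.

(** * The criterion for the limit law *)

Section Criterion.
Variables (R : realType) (mu : nat -> R) (tc : R).
Hypothesis mu_ge0 : forall j, 0 <= mu j.
Hypothesis mu_cvg : cvgn (pseries mu 1).
Hypothesis mu_sum : gf mu 1 = 1.
Hypothesis mu_nontrivial : exists2 j, (2 <= j)%N & 0 < mu j.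
Hypothesis tc_gt0 : 0 < tc.
Hypothesis tc_cvg : cvg_order2 _ (lag mu) tc.
Hypothesis tc_inflex : inflex _ (lag mu) tc = 0.
Implicit Types (q s x y : R).

Let H := gf (lag mu).
Let H1 := gf (pseries_diffs (lag mu)).
Let lag0 : forall j, 0 <= lag mu j. Proof. exact: lag_ge0. Qed.
Let lag_nontrivial : exists2 j, (3 <= j)%N & 0 < lag mu j.
Proof. by case: mu_nontrivial => j j2 muj; exists j.+1. Qed.

(** The function [phi] in terms of H = x G; it is the numerator of [tangent_at1]. *)
Definition phi_lag x := 2 * H x - (x - 1) * H1 x.

Let cvg_lag_le x : 0 <= x -> x <= tc -> cvg_order2 _ (lag mu) x.
Proof. by move=> x0 xt; apply: (cvg_order2_le _ _ lag0 x tc). Qed.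

Let H_gt0 x : 0 < x -> x <= tc -> 0 < H x.
Proof.
move=> x0 xt; have [j j2 muj] := lag_nontrivial.
by apply: (gf_gt0 _ _ _ j) => //; case: (cvg_lag_le x (ltW x0) xt).
Qed.

Let tangent_at1_sqr x : 0 < x -> x <= tc ->
  tangent_at1 _ (lag mu) x ^+ 2 * H x = phi_lag x ^+ 2.
Proof.
move=> x0 xt; have Hx := H_gt0 x x0 xt.
by rewrite /tangent_at1 expr_div_n sqr_sqrtr ?ltW // divfK // gt_eqF.
Qed.

Lemma left_limit_le (f : R -> R) s t M : s < t ->
  {within `[s, t], continuous f} ->
  (forall x, s <= x -> x < t -> f x <= M) -> f t <= M.
Proof.
move=> st cf fM; have /continuous_within_itvP [//|_ _ ft] := cf.
rewrite leNgt; apply/negP => Mft.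
have : \forall x \near t^'-, M < f x by apply: (cvgr_gt (f t)).
have l1 : \forall x \near t^'-, s <= x by apply: nbhs_left_ge.
have l2 : \forall x \near t^'-, x < t by exact: nbhs_left_lt.
move=> l3; have : \forall x \near t^'-, False.
  near=> x.
  have h1 : s <= x by near: x.
  have h2 : x < t by near: x.
  have h3 : M < f x by near: x.
  by have := fM x h1 h2; rewrite leNgt h3.
by move=> /filter_ex[].
Unshelve. all: by end_near. Qed.

(** * Necessity: following the larger branch from 1 *)

Section Necessary.
Variable q : R.
Hypotheses (q_gt : 1 / 2 < q) (q_lt1 : q < 1).
Let q_gt0 : 0 < q. Proof. by move: q_gt; lra. Qed.
Let q_ge0 : 0 <= q. Proof. exact: ltW. Qed.
Let a := lawlim _ mu q.
Hypothesis a_sum : gf a 1 = 1.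

Let a_ge0 : forall j, 0 <= a j. Proof. exact: lawlim_ge0. Qed.
Let a_fix := lawlim_fix _ mu mu_ge0 mu_cvg mu_sum q q_ge0 q_lt1.
Let a_cvg1 : cvgn (pseries a 1). Proof. exact: lawlim_cvg1. Qed.
Let c := q * a 0%N.
Let c_ge0 : 0 <= c. Proof. by rewrite mulr_ge0. Qed.
Let c_le1 : c <= 1.
Proof. by rewrite mulr_ile1 //; [exact: ltW|exact: lawlim0_le1]. Qed.
Let ellE x : ell _ q a x = 1 + (1 - c) * (x - 1).
Proof. by rewrite /ell -/c; ring. Qed.

(** The value is 2 q - 1. *)
Let bra1_gt0 : 0 < bra _ q a 1.
Proof. by rewrite /bra a_sum /ell subrr mulr0 subr0; move: q_gt; lra. Qed.

Let bra_le0 x := bra_le0_of_inflex _ q mu a q_ge0 q_lt1 mu_ge0 a_ge0 a_fix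
  mu_nontrivial tc x tc_cvg tc_inflex tc_gt0.

Lemma tc_gt1_of_sum1 : 1 < tc.
Proof.
rewrite ltNge; apply/negP => t1; have := bra_le0 1 t1 a_cvg1.
by rewrite leNgt bra1_gt0.
Qed.

Let tc1 := tc_gt1_of_sum1.

(** The quadratic equation gives F (q F - ell) = - (1 - q) H <= 0, hence q F <= ell <= x. This a
    priori bound allows a passage to the limit. *)
Let gf_le_ell x : 1 <= x -> cvgn (pseries a x) -> gf a x <= x / q.
Proof.
move=> x1 ca; have x0 : 0 <= x by exact: le_trans x1.
have := fix_quadratic _ q mu a q_ge0 q_lt1 mu_ge0 a_ge0 a_fix x x0 ca.
have h0 : 0 <= (1 - q) * gf (lag mu) x.
  rewrite mulr_ge0 ?subr_ge0 // ?(ltW q_lt1) // gf_ge0 //; apply: cvg_lag.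
  exact: (fix_cvg_mu _ q mu a q_ge0 q_lt1 mu_ge0 a_ge0 a_fix).
have F1 : 1 <= gf a x by rewrite -a_sum; apply: gf_le.
have lx : ell _ q a x <= x by rewrite /ell gerBl mulr_ge0 // subr_ge0.
move=> E; rewrite ler_pdivlMr // mulrC.
have : gf a x * (q * gf a x - ell _ q a x) <= 0 by lra.
by rewrite pmulr_rle0; lra.
Qed.

(** Points of [1, tc] up to which F stays on the larger branch; the two branches meet at the
    supremum [xs]. *)
Let S := [set x | [/\ 1 <= x, x <= tc, cvgn (pseries a x) &
  forall y, 1 <= y -> y <= x -> 0 < bra _ q a y]].
Let xs := sup S.

Let S1 : S 1.
Proof.
split=> //; first exact: ltW.
by move=> y y1 y2; rewrite (_ : y = 1) //; apply/le_anti/andP.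
Qed.
Let supS : has_sup S.
Proof. by split; [exists 1|exists tc => x []]. Qed.
Let xs1 : 1 <= xs. Proof. exact: sup_upper_bound. Qed.
Let xs_tc : xs <= tc. Proof. by apply: ge_sup; [exists 1|move=> x []]. Qed.

Let S_below x : 1 <= x -> x < xs -> S x.
Proof.
move=> x1 xx; have [|e [e1 et ec eb]] := @sup_adherent _ S (xs - x) _ supS.
  by rewrite subr_gt0.
rewrite subKr => xe; split => //; first exact: le_trans (ltW xx) xs_tc.
  by apply: pseries_cvg_le (ltW xe) ec => //; exact: le_trans x1.
by move=> y y1 yx; apply: eb => //; exact: le_trans (ltW xe).
Qed.

(** To the left of [xs] the partial sums are at most tc / q; as polynomials they keep this bound at
    [xs]. *)
Let xs_cvg : cvgn (pseries a xs).
Proof.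
move: xs1; rewrite le_eqVlt => /predU1P[<-//|x1].
apply: (@pseries_bounded_cvg _ _ _ (tc / q)) => //; first exact: le_trans xs1.
move=> n; apply: (@left_limit_le (pseries a ^~ n) 1 xs) => //.
  by apply: continuous_subspaceT; exact: pseries_continuous.
move=> x h1 h2; have [_ xt cx _] := S_below x h1 h2.
apply: le_trans (pseries_le_gf _ a x n a_ge0 (le_trans ler01 h1) cx) _.
by apply: le_trans (gf_le_ell x h1 cx) _; rewrite ler_pM2r // invr_gt0.
Qed.

Let bra_cont x t := bra_continuous _ q a a_ge0 x t.

Let bra_xs_ge0 : 0 <= bra _ q a xs.
Proof.
move: xs1; rewrite le_eqVlt => /predU1P[<-|x1]; first exact: ltW.
rewrite -oppr_le0; apply: (@left_limit_le (fun x => - bra _ q a x) 1 xs) => //.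
  by move=> z; apply: cvgN; exact: bra_cont.
move=> x h1 h2; have [_ _ _ xb] := S_below x h1 h2.
by rewrite oppr_le0 ltW // xb.
Qed.

(** A positive value is excluded at tc by [bra_le0]; before tc, extension and continuity would
    continue the larger branch past the supremum. *)
Let bra_xs : bra _ q a xs = 0.
Proof.
apply/eqP; rewrite eq_le bra_xs_ge0 andbT leNgt; apply/negP => P0.
have x0 : 0 < xs by exact: lt_le_trans xs1.
move: xs_tc; rewrite le_eqVlt => /predU1P[xt|xt].
  by have := bra_le0 xs; rewrite xt lexx -xt leNgt P0; move=> /(_ isT xs_cvg).
have [y xy cy] := bra_gt0_extension _ q mu a q_ge0 q_lt1 mu_ge0 a_ge0 a_fix xs x0 xs_cvg P0.
have cb := bra_cont xs y (ltW x0) cy.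
have /continuous_within_itvP [//|_ rc _] := cb.
have n1 : \forall x \near xs^'+, forall z, xs <= z -> z <= x -> 0 < bra _ q a z.
  have : \forall x \near xs^'+, 0 < bra _ q a x by apply: (cvgr_gt (bra _ q a xs)).
  move=> /nbhs_ballP[e /= e0 He].
  near=> x => z; rewrite le_eqVlt => /predU1P[<-//|xz] zx.
  apply: He => //; rewrite /ball /= distrC ger0_norm ?subr_ge0 ?ltW //.
  rewrite ltrBlDl; apply: le_lt_trans zx _.
  by near: x; apply: nbhs_right_lt; rewrite ltrDl.
have : \forall x \near xs^'+, False.
  near=> x.
  have xx : xs < x by near: x; exact: nbhs_right_gt.
  have xt' : x <= tc by near: x; exact: nbhs_right_le.
  have xy' : x <= y by near: x; exact: nbhs_right_le.
  have Bx : forall z, xs <= z -> z <= x -> 0 < bra _ q a z by near: x.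
  have : S x.
    split => //; first exact: le_trans xs1 (ltW xx).
      by apply: pseries_cvg_le xy' cy => //; exact: ltW (lt_trans x0 xx).
    move=> z z1 zx; case: (ltP z xs) => zxs; last exact: Bx.
    by have [_ _ _] := S_below z z1 zxs; apply.
  by move=> /(sup_upper_bound supS); rewrite leNgt xx.
by move=> /filter_ex[].
Unshelve. all: by end_near. Qed.

(** At [xs] the line [ell] meets sqrt (k H), k = 4 q (1 - q), with a slope at least as large. So the
    tangent to sqrt (k H) at [xs] is at least [ell 1 = 1] at the point 1, and [tangent_at1_le]
    carries this to tc. *)
Lemma necessary_condition : H tc <= q * (1 - q) * phi_lag tc ^+ 2.
Proof.
have x1 : 1 < xs.
  by rewrite lt_neqAle xs1 andbT; apply: contraTneq bra1_gt0 => ->; rewrite bra_xs ltxx.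
have x0 : 0 < xs by exact: lt_trans x1.
have Fxs : 2 * q * gf a xs = ell _ q a xs by have := bra_xs; rewrite /bra; lra.
have [c0 c1 c2] := cvg_lag_le xs (ltW x0) xs_tc.
(* F' may be infinite at [xs]. The differentiated equation is used to the left, where bra F' >= 0,
   before taking the limit. *)
have H1le : (1 - q) * H1 xs <= (1 - c) * gf a xs.
  apply: (@left_limit_le (fun x => (1 - q) * H1 x) 1 xs) => //.
    apply/subspace_continuousP => z zin; apply: cvgMr.
    exact: (gf_cvg_within _ _ _ _ z (pseries_diffs_ge0 _ _ lag0) ler01 c1 zin).
  move=> x h1 h2; have [_ _ cx xb] := S_below x h1 h2.
  have x00 : 0 < x by exact: lt_le_trans h1.
  have := fix_derive1 _ q mu a q_ge0 q_lt1 mu_ge0 a_ge0 a_fix x xs x00 h2 xs_cvg.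
  rewrite -/c -/H1 => E.
  have b0 : 0 <= bra _ q a x * gf (pseries_diffs a) x.
    rewrite mulr_ge0 //; first by rewrite ltW // xb.
    apply: gf_ge0; [exact: pseries_diffs_ge0|exact: ltW|].
    exact: cvg_pseries_diffs (ltW x00) h2 xs_cvg.
  have : (1 - c) * gf a x <= (1 - c) * gf a xs.
    by rewrite ler_wpM2l ?subr_ge0 //; apply: gf_le => //; exact: ltW.
  lra.
have := bra_sqr _ q mu a q_ge0 q_lt1 mu_ge0 a_ge0 a_fix xs (ltW x0) xs_cvg.
rewrite bra_xs expr0n /= -/H => lH.
pose l := ell _ q a xs; pose k := 4 * q * (1 - q).
have k0 : 0 < k by rewrite !mulr_gt0 // subr_gt0.
have l0 : 0 < l.
  by rewrite /l ellE ltr_wpDr // mulr_ge0 // subr_ge0 // ltW.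
have kphi : 2 * l <= k * phi_lag xs.
  have -> : k * phi_lag xs = 2 * (k * H xs) - (xs - 1) * (4 * q * ((1 - q) * H1 xs)).
    by rewrite /phi_lag /k; ring.
  have -> : k * H xs = l ^+ 2 by rewrite /k /l; lra.
  have : (xs - 1) * (4 * q * ((1 - q) * H1 xs)) <= (xs - 1) * (2 * ((1 - c) * l)).
    rewrite ler_wpM2l ?subr_ge0 //.
    have -> : 2 * ((1 - c) * l) = 4 * q * ((1 - c) * gf a xs) by rewrite /l -Fxs; ring.
    by rewrite ler_wpM2l // mulr_ge0.
  (* The inserted factor is [ell 1 = 1], computed from its value at [xs]. *)
  have -> : 2 * l = 2 * (l * (l - (1 - c) * (xs - 1))) by rewrite {3}/l ellE; ring.
  lra.
have phi0 : 0 < phi_lag xs by rewrite -(pmulr_rgt0 _ k0); apply: lt_le_trans kphi; rewrite mulr_gt0.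
have kphi2 : 4 * H xs <= k * phi_lag xs ^+ 2.
  rewrite -(ler_pM2l k0).
  have -> : k * (4 * H xs) = (2 * l) ^+ 2 by move: lH; rewrite -/l /k; lra.
  have -> : k * (k * phi_lag xs ^+ 2) = (k * phi_lag xs) ^+ 2 by ring.
  by rewrite lerXn2r // nnegrE mulr_ge0 // ltW.
have Hxs := H_gt0 xs x0 xs_tc; have Htc := H_gt0 tc tc_gt0 (lexx _).
have T0 : 0 < tangent_at1 _ (lag mu) xs.
  by rewrite /tangent_at1 -/H -/H1 -/(phi_lag xs) divr_gt0 // sqrtr_gt0.
have TT := tangent_at1_le _ _ lag0 lag_nontrivial tc tc_cvg tc_inflex xs tc xs1 xs_tc (lexx _).
have k4 : 4 <= k * tangent_at1 _ (lag mu) xs ^+ 2.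
  rewrite -(ler_pM2r Hxs) -mulrA tangent_at1_sqr //.
have k4' : 4 <= k * tangent_at1 _ (lag mu) tc ^+ 2.
  apply: le_trans k4 _; rewrite ler_pM2l // lerXn2r // nnegrE ltW //.
  exact: lt_le_trans TT.
have : 4 * H tc <= k * phi_lag tc ^+ 2.
  by rewrite -tangent_at1_sqr // mulrA ler_pM2r.
rewrite /k; lra.
Qed.

End Necessary.

(** * Sufficiency: a continuity argument in the parameter s *)

Section Sufficient.
Hypothesis tc_gt1 : 1 < tc.

Let mu_cvg_tc : cvgn (pseries mu tc).
Proof. by case: tc_cvg => /cvg_shift. Qed.
Let G := gf mu tc.

Let G_ge1 : 1 <= G.
Proof. by rewrite -[leLHS]mu_sum; apply: gf_le => //; exact: ltW. Qed.

Let bounded s M n := forall m, pseries (law _ mu s n) tc m <= M.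

Let tc_ge0 : 0 <= tc. Proof. exact: ltW. Qed.

(** The condition is a product because its left side is positive, which forces the denominator in
    [law_bound_step] to be positive. *)
Let bounded_step s n M M' : 0 <= s -> s < 1 -> bounded s M n -> 0 < M' ->
  (1 - s) * (tc * G) <= M' * (tc - s * law _ mu s n 0 * (tc - 1) - s * M) ->
  bounded s M' n.+1.
Proof.
move=> s0 s1 bM M0 h m.
have D0 : 0 < tc - s * law _ mu s n 0 * (tc - 1) - s * M.
  rewrite -(pmulr_rgt0 _ M0); apply: lt_le_trans h.
  by rewrite !mulr_gt0 ?subr_gt0 // (lt_le_trans ltr01).
apply: le_trans (law_bound_step _ mu mu_ge0 mu_cvg mu_sum s s0 s1 n tc M tc_gt0
  mu_cvg_tc bM D0 m) _.
by rewrite ler_pdivrMr.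
Qed.

Let bounded_cvg s n M : 0 <= s -> s < 1 -> bounded s M n ->
  cvgn (pseries (law _ mu s n) tc).
Proof.
by move=> s0 s1; apply: pseries_bounded_cvg => //; exact: law_ge0.
Qed.

Let S := [set s | [/\ 0 <= s, s < 1 & exists M, forall n, bounded s M n]].

Let S0 : S 0.
Proof.
split=> //; exists G; elim=> [|n IH].
  move=> m; apply: (@le_trans _ _ 1) => //.
  case: m => [|m]; first by rewrite pseriesE big_ord0.
  by rewrite pseriesS_l /= big1 ?addr0 // => i _; rewrite mul0r.
apply: bounded_step IH _ _ => //; first exact: lt_le_trans G_ge1.
by rewrite !mul0r !subr0 mul1r mulrC.
Qed.

(** [tangent_at1] equals 2 sqrt (H 1) > 0 at 1 and is nondecreasing up to tc. *)
Lemma phi_lag_gt0 : 0 < phi_lag tc.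
Proof.
have T1 : tangent_at1 _ (lag mu) 1 <= tangent_at1 _ (lag mu) tc.
  by apply: (tangent_at1_le _ _ lag0 lag_nontrivial tc tc_cvg tc_inflex) => //; exact: ltW.
have h1 := H_gt0 1 ltr01 (ltW tc_gt1); have h2 := H_gt0 tc tc_gt0 (lexx _).
have : 0 < tangent_at1 _ (lag mu) tc.
  apply: lt_le_trans T1; rewrite /tangent_at1 subrr mul0r subr0.
  by rewrite divr_gt0 ?sqrtr_gt0 // mulr_gt0.
by rewrite /tangent_at1 -/H -/H1 -/(phi_lag tc) pmulr_lgt0 // invr_gt0 sqrtr_gt0.
Qed.

(** [inflex] equals - mu 0 ^+ 2 at 0 and increases strictly to 0 at tc. *)
Let mu0_gt0 : 0 < mu 0%N.
Proof.
rewrite lt_neqAle mu_ge0 andbT; apply/eqP => m0.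
have := inflex_lt _ _ lag0 lag_nontrivial 0 tc (lexx _) tc_gt0 tc_cvg.
rewrite tc_inflex /inflex !gf_at0 /= /pseries_diffs /= -m0.
by rewrite mul0r !mulr0 expr0n subr0 ltxx.
Qed.

Section InS.
Variable s : R.
Hypothesis sS : S s.
Let s_ge0 : 0 <= s. Proof. by case: sS. Qed.
Let s_lt1 : s < 1. Proof. by case: sS. Qed.
Let a := lawlim _ mu s.
Let a_ge0 : forall j, 0 <= a j. Proof. exact: lawlim_ge0. Qed.
Let a_fix := lawlim_fix _ mu mu_ge0 mu_cvg mu_sum s s_ge0 s_lt1.
Let a_cvg1 : cvgn (pseries a 1). Proof. exact: lawlim_cvg1. Qed.

Let a_cvg : cvgn (pseries a tc).
Proof.
have [_ _ [M bM]] := sS; apply: (@pseries_bounded_cvg _ _ _ M) => // m.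
have l1 := pseries_lawlim _ mu mu_ge0 mu_cvg mu_sum s s_ge0 s_lt1 tc m.
by apply: (cvgn_le _ _ _ _ _ l1 (cvg_cst M)) => n; exact: bM.
Qed.

(** Since tc > 1, Markov's inequality gives P(X_n > j) <= M / tc^(j+1) for every n. The laws are
    tight and no mass escapes. *)
Lemma bounded_sum1 : gf a 1 = 1.
Proof.
have [_ _ [M bM]] := sS.
apply/eqP; rewrite eq_le; apply/andP; split.
  apply: gf_le_bound => // -[|n]; first by rewrite pseriesE big_ord0.
  rewrite -cumul_pseries; apply: le_trans (cumul_lawlim_le _ mu mu_ge0 mu_cvg mu_sum s s_ge0 s_lt1 0 n) _.
  exact: cumul_law_le1.
have tail j : 1 - M * tc^-1 ^+ j.+1 <= gf a 1.
  apply: (@le_trans _ _ (cumul a j)); last first.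
    by rewrite cumul_pseries pseries_le_gf.
  have l1 := cumul_lawlim _ mu mu_ge0 mu_cvg mu_sum s s_ge0 s_lt1 j.
  apply: (cvgn_le _ _ _ _ _ (cvg_cst (1 - M * tc^-1 ^+ j.+1)) l1) => n /=.
  have l0 := law_ge0 _ mu mu_ge0 mu_cvg mu_sum s s_ge0 s_lt1 n.
  have lc := bounded_cvg s n M s_ge0 s_lt1 (bM n).
  have := gf1_tail_le _ _ tc j.+1 l0 (ltW tc_gt1) lc.
  rewrite law_sum // -cumul_pseries => h.
  have p : 0 < tc ^+ j.+1 by rewrite exprn_gt0.
  have : tc ^+ j.+1 * (1 - cumul (law R mu s n) j) <= M.
    apply: le_trans h _; apply: (@le_trans _ _ (gf (law R mu s n) tc)).
      by rewrite gerBl pseries_ge0.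
    by apply: gf_le_bound => //; exact: bM.
  rewrite -ler_pdivlMl // exprVn mulrC; lra.
have l : 1 - M * tc^-1 ^+ j.+1 @[j --> \oo] --> (1 - M * 0 : R).
  apply: cvgB; first exact: cvg_cst.
  apply: cvgMr; rewrite (cvg_shiftS (fun j => tc^-1 ^+ j)); apply: cvg_expr.
  by rewrite ger0_norm ?invr_ge0 // invf_lt1.
rewrite mulr0 subr0 in l.
by apply: (cvgn_le _ _ _ _ _ l (cvg_cst (gf a 1))).
Qed.

(** X_n is stochastically dominated by X, which has full mass; the arbitrary bound M is thus
    improved to F(tc). *)
Lemma bounded_by_lim n : bounded s (gf a tc) n.
Proof.
move=> m; apply: pseries_cumul_le => //; first exact: ltW.
- by move=> j; exact: cumul_law_le1.
- by move=> j; exact: cumul_lawlim_le.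
- exact: bounded_sum1.
Qed.

Let ell_le : ell _ s a tc <= tc.
Proof. by rewrite /ell gerBl !mulr_ge0 // subr_ge0 ltW. Qed.

Lemma bounded_bra_le0 : bra _ s a tc <= 0.
Proof.
by apply: (bra_le0_of_inflex _ s mu a s_ge0 s_lt1 mu_ge0 a_ge0 a_fix
  mu_nontrivial tc tc tc_cvg tc_inflex tc_gt0).
Qed.

(** A bound depending on s and tc only, which makes [S] closed at positive parameters. *)
Lemma bounded_gf_le : 2 * s * gf a tc <= tc.
Proof. by have := bounded_bra_le0; rewrite /bra; move: ell_le; lra. Qed.

(** Upper semicontinuity in s at a fixed height. A bound slightly above f at height n gives, through
    the recursion, a strict bound M at height n.+1, and strictness persists for nearby
    parameters. *)
Let bounded_near n M : gf (law _ mu s n) tc < M ->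
  \forall s' \near s, 0 <= s' -> s' < 1 -> bounded s' M n.
Proof.
elim: n M => [|n IH] M.
  move=> hM; near=> s' => s'0 s'1 m; apply: le_trans (ltW hM).
  have [_ _ [M' bM]] := sS.
  have l0 := law_ge0 _ mu mu_ge0 mu_cvg mu_sum s s_ge0 s_lt1 0%N.
  have lc := bounded_cvg s 0%N M' s_ge0 s_lt1 (bM 0%N).
  exact: pseries_le_gf _ _ tc m l0 tc_ge0 lc.
have [_ _ [M' bM]] := sS => hM.
have cn := bounded_cvg s n M' s_ge0 s_lt1 (bM n).
have cS := bounded_cvg s n.+1 M' s_ge0 s_lt1 (bM n.+1).
have := law_gf_step _ mu mu_ge0 mu_cvg mu_sum s s_ge0 s_lt1 n tc tc_gt0 mu_cvg_tc cn cS.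
set f := gf (law _ mu s n) tc; set f' := gf (law _ mu s n.+1) tc in hM *.
set D := _ - _ - _ => E.
have f'0 : 0 <= f' by apply: gf_ge0 => //; exact: law_ge0.
have P0 : 0 < (1 - s) * (tc * G).
  by rewrite !mulr_gt0 ?subr_gt0 // (lt_le_trans ltr01).
have D0 : 0 < D.
  rewrite ltNge; apply/negP => D0; have : D * f' <= 0 by rewrite mulr_le0_ge0.
  by rewrite E leNgt P0.
have M0 : 0 < M by exact: le_lt_trans hM.
(* Raising f by e costs s M e, at most half of the gap (M - f') D. *)
pose e := (M - f') * D / (2 * M).
have e0 : 0 < e by rewrite divr_gt0 ?mulr_gt0 // subr_gt0.
have He : M * e = (M - f') * D / 2 by rewrite /e; field; rewrite gt_eqF.
have fe : f < f + e by rewrite ltrDl.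
have strict : (1 - s) * (tc * G) < M * (tc - s * law _ mu s n 0 * (tc - 1) - s * (f + e)).
  have -> : M * (tc - s * law _ mu s n 0 * (tc - 1) - s * (f + e)) = M * D - s * (M * e).
    by rewrite /D; ring.
  rewrite -E; have MD : 0 < (M - f') * D by rewrite mulr_gt0 // subr_gt0.
  have : s * (M * e) <= M * e by rewrite ler_piMl // ?(ltW s_lt1) // mulr_ge0 // ltW.
  rewrite He; lra.
have near1 : \forall s' \near s, (1 - s') * (tc * G) <
    M * (tc - s' * law _ mu s' n 0 * (tc - 1) - s' * (f + e)).
  pose g s' := M * (tc - s' * law _ mu s' n 0 * (tc - 1) - s' * (f + e)) - (1 - s') * (tc * G).
  have cg : g x @[x --> s] --> g s.
    have ci : x @[x --> s] --> s by exact: cvg_id.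
    have cl : law _ mu x n 0 @[x --> s] --> law _ mu s n 0 by exact: law_continuous.
    apply: cvgB; last by apply: cvgMl; apply: cvgB => //; exact: cvg_cst.
    apply: cvgMr; apply: cvgB; last exact: cvgMl.
    by apply: cvgB; [exact: cvg_cst|apply: cvgMl; exact: cvgM].
  have : \forall s' \near s, 0 < g s' by apply: (cvgr_gt _ cg); rewrite /g subr_gt0.
  by apply: filterS => s'; rewrite /g subr_gt0.
have near2 := IH (f + e) fe.
near=> s' => s'0 s'1.
have h1 : (1 - s') * (tc * G) <
    M * (tc - s' * law _ mu s' n 0 * (tc - 1) - s' * (f + e)) by near: s'.
have h2 : 0 <= s' -> s' < 1 -> bounded s' (f + e) n by near: s'.
by apply: bounded_step (h2 s'0 s'1) M0 (ltW h1).
Unshelve. all: by end_near. Qed.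

(* With [2 * s * F < ell] the fixed point [F] is stable, so some [M > F] is a
   strict supersolution; this persists for nearby parameters because
   [law s' n 0] is nonincreasing in [n]. *)
Lemma bounded_open : bra _ s a tc < 0 ->
  \forall s' \near s, 0 <= s' -> s' < 1 -> S s'.
Proof.
move=> b0; set F := gf a tc.
(* For s > 0 the other root of the quadratic is F - bra / s, so M lies between the two roots. Then
   [g (s * a 0) s], minus the quadratic at M, is positive; this also holds at s = 0. *)
pose M := F - bra _ s a tc / 2.
have F0 : 0 <= F by exact: gf_ge0.
have FM : F < M by rewrite /M; lra.
have M0 : 0 < M by exact: le_lt_trans FM.
pose g c s' := M * (tc - c * (tc - 1) - s' * M) - (1 - s') * (tc * G).
have g0 : 0 < g (s * a 0%N) s.
  have := fix_quadratic _ s mu a s_ge0 s_lt1 mu_ge0 a_ge0 a_fix tc tc_ge0 a_cvg.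
  rewrite gf_lag // -/F -/G => E.
  have -> : g (s * a 0%N) s = bra _ s a tc ^+ 2 / 2 * (1 - s / 2).
    have -> : g (s * a 0%N) s = g (s * a 0%N) s +
      (s * F ^+ 2 - ell R s a tc * F + (1 - s) * (tc * G)) by rewrite E addr0.
    by rewrite /g /M /bra -/F /ell; field.
  rewrite mulr_gt0 //; last by move: s_lt1; lra.
  by rewrite divr_gt0 // exprn_even_gt0 //= lt_eqF.
have ci : x @[x --> s] --> s by exact: cvg_id.
have [N gN] : exists N, 0 < g (s * law _ mu s N 0) s.
  have l1 : g (s * law _ mu s n 0) s @[n --> \oo] --> g (s * a 0%N) s.
    apply: cvgB; last exact: cvg_cst.
    apply: cvgMr; apply: cvgB; last exact: cvg_cst.
    apply: cvgB; first exact: cvg_cst.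
    by apply: cvgMl; apply: cvgMr; exact: law_cvg_lim.
  have : \forall n \near \oo, 0 < g (s * law _ mu s n 0) s.
    exact: (cvgr_gt _ l1).
  by move=> [N _ HN]; exists N; exact: (HN N (leqnn N)).
have near1 : \forall s' \near s, 0 < g (s' * law _ mu s' N 0) s'.
  have cg : g (x * law _ mu x N 0) x @[x --> s] --> g (s * law _ mu s N 0) s.
    have cl : law _ mu x N 0 @[x --> s] --> law _ mu s N 0 by exact: law_continuous.
    apply: cvgB; last by apply: cvgMl; apply: cvgB => //; exact: cvg_cst.
    apply: cvgMr; apply: cvgB; last exact: cvgMl.
    by apply: cvgB; [exact: cvg_cst|apply: cvgMl; exact: cvgM].
  exact: (cvgr_gt _ cg).
have near2 : \forall s' \near s, 0 <= s' -> s' < 1 -> bounded s' M N.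
  apply: bounded_near; apply: le_lt_trans FM; apply: gf_le_bound; last exact: bounded_by_lim.
  exact: bounded_cvg (bounded_by_lim N).
near=> s' => s'0 s'1.
have h1 : 0 < g (s' * law _ mu s' N 0) s' by near: s'.
have h2 : bounded s' M N by move: s'0 s'1; near: s'.
split => //; exists M => n.
have l0 := law_ge0 _ mu mu_ge0 mu_cvg mu_sum s' s'0 s'1.
(* Up to height N the bound follows from stochastic monotonicity; beyond N, M is reproduced by
   [bounded_step]. *)
case: (leqP n N) => [nN|/ltnW Nn].
  move=> m; have cN := bounded_cvg s' N M s'0 s'1 h2.
  apply: (@le_trans _ _ (gf (law _ mu s' N) tc)); last exact: gf_le_bound.
  apply: pseries_cumul_le => //; first exact: ltW.
  - by move=> j; exact: cumul_law_le1.
  - by move=> j; exact: cumul_law_le.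
  - exact: law_sum.
rewrite -(subnKC Nn); elim: (n - N)%N => [|i IH]; first by rewrite addn0.
rewrite addnS; apply: (bounded_step _ _ _ _ s'0 s'1 IH M0).
apply: le_trans (_ : M * (tc - s' * law _ mu s' N 0 * (tc - 1) - s' * M) <= _).
  by move: h1; rewrite /g; lra.
rewrite ler_pM2l // lerD2r lerD2l lerN2 ler_wpM2r ?subr_ge0 ?(ltW tc_gt1) // ler_wpM2l //.
have := cumul_law_le _ mu mu_ge0 mu_cvg mu_sum s' s'0 s'1 N (N + i) 0 (leq_addr _ _).
by rewrite /cumul !big_ord1.
Unshelve. all: by end_near. Qed.

Variable q : R.
Hypothesis q_cond : H tc <= q * (1 - q) * phi_lag tc ^+ 2.

(** Suppose [bra] vanishes at tc. If 0 < s <= 1 / 2, [ell] is already tangent at some y < tc, and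
    strict concavity puts the curve below it at tc. If s > 1 / 2, comparing slopes at tc gives s (1
    - s) phi^2 <= H <= q (1 - q) phi^2, but s (1 - s) decreases beyond 1 / 2. *)
Lemma bounded_bra_lt0 : s < q -> bra _ s a tc < 0.
Proof.
move=> sq; rewrite lt_neqAle bounded_bra_le0 andbT; apply/eqP => b0.
move: s_ge0; rewrite le_eqVlt => /predU1P[s0|s0].
  by move: b0; rewrite /bra /ell -s0 !(mulr0, mul0r) sub0r subr0; move: tc_gt0; lra.
pose k := 4 * s * (1 - s); have k0 : 0 < k by rewrite !mulr_gt0 // subr_gt0.
have sqr x := bra_sqr _ s mu a s_ge0 s_lt1 mu_ge0 a_ge0 a_fix x.
have lH : ell _ s a tc ^+ 2 = k * H tc.
  by have := sqr tc tc_ge0 a_cvg; rewrite b0 expr0n /= /k /H; lra.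
pose c := s * a 0%N.
have c0 : 0 <= c by rewrite mulr_ge0.
have c1 : c < 1.
  by apply: le_lt_trans s_lt1; rewrite ler_piMr //; exact: lawlim0_le1.
have ellE x : ell _ s a x = c + (1 - c) * x by rewrite /ell -/c; ring.
(* Here [bra] is c > 0 at 0 and 2 s - 1 <= 0 at 1, hence vanishes in between. *)
case: (leP s (1 / 2)) => s_half.
  have a0p : 0 < a 0%N by apply: (fix_gt0 R s mu) mu0_gt0 => //; exact: a_fix.
  have cb := bra_continuous _ s a a_ge0 0 1 (lexx _) a_cvg1.
  have br0 : bra _ s a 0 = c by rewrite /bra ellE gf_at0 /c; ring.
  have br1 : bra _ s a 1 <= 0 by rewrite /bra bounded_sum1 ellE; lra.
  have [|y] := IVT (v := 0) ler01 cb.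
    by rewrite br0 ge_min le_max c0 br1 orbT.
  rewrite in_itv /= => /andP[y0 y1] by0.
  have yp : 0 < y.
    rewrite lt_neqAle y0 andbT; apply/eqP => y00; move: by0.
    by rewrite -y00 br0 => /eqP; rewrite gt_eqF // mulr_gt0.
  have yt : y < tc by exact: le_lt_trans tc_gt1.
  have [e1 e2] := bra_eq0_tangent _ s mu a s_ge0 s_lt1 mu_ge0 a_ge0 a_fix y tc yp yt a_cvg by0.
  have ly : 0 < ell _ s a y.
    by rewrite ellE ltr_wpDl // mulr_gt0 // subr_gt0.
  have := tangent_above _ _ lag0 lag_nontrivial tc tc_cvg tc_inflex k _ (1 - c) y yp yt k0 ly e1 e2.
  have -> : ell _ s a y + (1 - c) * (tc - y) = ell _ s a tc by rewrite !ellE; ring.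
  by rewrite lH ltxx.
have [cl0 cl1 _] := tc_cvg.
have l1 : ell _ s a tc = 1 + (1 - c) * (tc - 1) by rewrite ellE; ring.
have lp : 0 < ell _ s a tc by rewrite l1 ltr_wpDr // mulr_ge0 // subr_ge0 ltW.
(* The discriminant ell^2 - k H = bra^2 is nonnegative before tc and zero at tc. Comparing
   increments from z to tc and letting z tend to tc compares the slopes. *)
have key : 2 * (1 - c) * ell _ s a tc <= k * H1 tc.
  have step z : 0 <= z -> z < tc ->
      2 * (1 - c) * ell _ s a tc - (1 - c) ^+ 2 * (tc - z) <= k * H1 tc.
    move=> z0 zt; have cz : cvgn (pseries a z) by apply: pseries_cvg_le (ltW zt) a_cvg.
    have h1 := gf_sub_le _ _ z tc lag0 z0 (ltW zt) cl0 cl1.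
    have h2 := sqr z z0 cz; have h3 := sqr_ge0 (bra _ s a z).
    have h4 : k * (gf (lag mu) tc - gf (lag mu) z) <= k * (H1 tc * (tc - z)).
      by rewrite ler_pM2l.
    rewrite -(@ler_pM2r _ (tc - z)) ?subr_gt0 //.
    have -> : (2 * (1 - c) * ell _ s a tc - (1 - c) ^+ 2 * (tc - z)) * (tc - z)
      = ell _ s a tc ^+ 2 - ell _ s a z ^+ 2 by rewrite !ellE; ring.
    by move: h4 h3 h2 lH; rewrite /k /H; lra.
  pose f z := 2 * (1 - c) * ell _ s a tc - (1 - c) ^+ 2 * (tc - z).
  have cf : {within `[0, tc], continuous f}.
    apply: continuous_subspaceT => z; apply: cvgB; first exact: cvg_cst.
    by apply: cvgMr; apply: cvgB; [exact: cvg_cst|exact: cvg_id].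
  by have := left_limit_le f 0 tc _ tc_gt0 cf step; rewrite /f subrr mulr0 subr0.
have kphi : k * phi_lag tc <= 2 * ell _ s a tc.
  have -> : k * phi_lag tc = 2 * (k * H tc) - (tc - 1) * (k * H1 tc).
    by rewrite /phi_lag; ring.
  have : (tc - 1) * (2 * (1 - c) * ell _ s a tc) <= (tc - 1) * (k * H1 tc).
    by rewrite ler_wpM2l // subr_ge0 ltW.
  have -> : 2 * ell _ s a tc = 2 * (ell _ s a tc * (ell _ s a tc - (1 - c) * (tc - 1))).
    by rewrite {3}l1; ring.
  by rewrite -lH; lra.
have phi0 := phi_lag_gt0.
have kphi2 : k * phi_lag tc ^+ 2 <= 4 * H tc.
  rewrite -(ler_pM2l k0).
  have -> : k * (4 * H tc) = (2 * ell _ s a tc) ^+ 2 by rewrite exprMn lH; ring.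
  have -> : k * (k * phi_lag tc ^+ 2) = (k * phi_lag tc) ^+ 2 by ring.
  by rewrite lerXn2r // nnegrE mulr_ge0 // ltW.
have p2 : 0 < phi_lag tc ^+ 2 by rewrite exprn_gt0.
have : s * (1 - s) * phi_lag tc ^+ 2 <= q * (1 - q) * phi_lag tc ^+ 2.
  by apply: le_trans q_cond; move: kphi2; rewrite /k; lra.
rewrite ler_pM2r // => le1.
have : 0 < (q - s) * (q + s - 1) by rewrite mulr_gt0 //; lra.
by lra.
Qed.

End InS.

Lemma sufficient_condition q : 0 <= q -> q < 1 ->
  H tc <= q * (1 - q) * phi_lag tc ^+ 2 -> gf (lawlim _ mu q) 1 = 1.
Proof.
move=> q0 q1 hq; apply: bounded_sum1.
pose S' := [set s | S s /\ s <= q]; pose t := sup S'.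
have S'0 : S' 0 by split.
have supS : has_sup S' by split; [exists 0|exists q => s []].
have t0 : 0 <= t by exact: sup_upper_bound.
have tq : t <= q by apply: ge_sup; [exists 0|move=> s []].
have t1 : t < 1 by exact: le_lt_trans q1.
have St : S t.
  case: (eqVneq t 0) => [->//|tn0]; have tp : 0 < t by rewrite lt_neqAle eq_sym tn0.
  (* A partial sum above tc / t at t would stay above it at some s in [S'] with t / 2 < s <= t,
     where F(tc) <= tc / (2 s) < tc / t. *)
  split => //; exists (tc / t) => n m.
  rewrite leNgt; apply/negP => big.
  have cp := pseries_law_continuous _ mu mu_ge0 mu_cvg mu_sum n tc m t t0 t1.
  have : \forall s \near t, tc / t < pseries (law _ mu s n) tc m.
    exact: (cvgr_gt _ cp).
  move=> /nbhs_ballP[e /= e0 He].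
  have d0 : 0 < Num.min e (t / 2) by rewrite lt_min e0 divr_gt0.
  have [s [sS sq] ts] := sup_adherent d0 supS.
  have st : s <= t by apply: sup_upper_bound.
  move: ts; rewrite -/t ltrBlDr -ltrBlDl lt_min => /andP[ts1 ts2].
  have := He s; rewrite /ball /= ger0_norm ?subr_ge0 // => /(_ ts1).
  rewrite ltNge; apply/negP; rewrite negbK.
  apply: le_trans (bounded_by_lim s sS n m) _.
  have sp : 0 < s by lra.
  have := bounded_gf_le s sS => h.
  rewrite ler_pdivlMr //; apply: le_trans h; rewrite mulrC ler_wpM2r //; last by lra.
  apply: gf_ge0 => //; first by case: sS => ? ? _; exact: lawlim_ge0.
  have [s0 s1 [M bM]] := sS.
  apply: (@pseries_bounded_cvg _ _ _ M) => //; first exact: lawlim_ge0.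
  move=> k; have l1 := pseries_lawlim _ mu mu_ge0 mu_cvg mu_sum s s0 s1 tc k.
  by apply: (cvgn_le _ _ _ _ _ l1 (cvg_cst M)) => j; exact: bM.
move: tq; rewrite le_eqVlt => /predU1P[<-//|tq].
have := bounded_open t St (bounded_bra_lt0 t St q hq tq).
move=> /nbhs_ballP[e /= e0 He].
pose s := Num.min q (t + e / 2).
have ts : t < s by rewrite lt_min tq ltrDl divr_gt0.
have sq : s <= q by rewrite ge_min lexx.
have : S' s.
  split=> //; apply: He; [|exact: le_trans (ltW ts)|exact: le_lt_trans q1].
  rewrite /ball /= distrC ger0_norm ?subr_ge0 ?(ltW ts) // ltrBlDl.
  by rewrite gt_min orbC ltrD2l; apply/orP; left; lra.
by move=> /(sup_upper_bound supS); rewrite leNgt -/t ts.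
Qed.

End Sufficient.
End Criterion.

(** * The parking process *)

Lemma series_finite_support (R : realType) (p : nat -> R) j :
  (forall i, (j < i)%N -> p i = 0) -> series p @ \oo --> \sum_(i < j.+1) p i.
Proof.
move=> p0; apply: cvg_near_cst; exists j.+1 => // n /= jn.
rewrite -(subnKC jn) /series /= big_mkord big_split_ord /= [X in _ + X]big1 ?addr0 //.
by move=> i _; rewrite p0 //= ltnS leq_addr.
Qed.

Section ParkingLaw.
Variables (d : measure_display) (T : measurableType d) (R : realType).
Variables (P : probability T R) (q : R) (mu : nat -> R).
Variables k A : seq nat -> T -> nat.
Hypotheses (q_ge0 : 0 <= q) (q_lt1 : q < 1).
Hypothesis mu_ge0 : forall j, 0 <= mu j.
Hypothesis mu_cvg : cvgn (pseries mu 1).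
Hypothesis mu_sum : gf mu 1 = 1.
Hypothesis parking : GW_parking_law P q mu k A.
Implicit Types (D : seq nat -> bool) (E : set T) (u v : seq nat).

Definition cyl (s : seq (seq nat)) (kf af : seq nat -> nat) : set T :=
  \bigcap_(u in [set` s]) [set w | k u w = kf u /\ A u w = af u].

Definition weight (s : seq (seq nat)) (kf af : seq nat -> nat) : R :=
  \prod_(u <- s) (q ^+ kf u * (1 - q) * mu (af u)).

(* [described D E p]: the event [E], of probability [p], is a countable disjoint
   union of (iterated unions of) cylinders on words in [D].  Events described
   by disjoint sets of words are independent. *)
Inductive described D : set T -> R -> Prop :=
| described_cyl s kf af : uniq s -> all D s ->
    described D (cyl s kf af) (weight s kf af)
| described_set0 : described D set0 0
| described_bigcup (E : nat -> set T) p r : (forall i, described D (E i) (p i)) ->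
    trivIset setT E -> series p @ \oo --> r -> described D (\bigcup_i E i) r.

Lemma described_measure D E p : described D E p ->
  measurable E /\ P E = p%:E.
Proof.
have [mk [mA law_cyl]] := parking.
elim=> {E p} [s kf af us _||E p r _ IH tE pr].
- split; last exact: law_cyl.
  apply: fin_bigcap_measurable => // u _.
  exact: (measurableI _ _ (mk u (kf u)) (mA u (af u))).
- by rewrite measure0.
have mE i : measurable (E i) by case: (IH i).
split; first exact: bigcupT_measurable.
rewrite measure_semi_bigcup //; last exact: bigcupT_measurable.
rewrite (@eq_eseriesr _ _ (fun i => (p i)%:E)); last by move=> i _; case: (IH i).
have -> : (fun n => \sum_(0 <= i < n) (p i)%:E)%E = EFin \o series p.
  by apply/funext => n /=; rewrite sumEFin.
by rewrite EFin_lim ?(cvg_lim _ pr) //; apply/cvg_ex; exists r.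
Qed.

Lemma described_sub D D' E p : (forall u, D u -> D' u) ->
  described D E p -> described D' E p.
Proof.
move=> DD'; elim=> {E p} [s kf af us Ds||E p r _ IH tE pr].
- by apply: described_cyl => //; exact: sub_all Ds.
- exact: described_set0.
- exact: described_bigcup IH tE pr.
Qed.

(** Independence of disjoint families of words: weights multiply when disjoint lists are
    concatenated, and countable disjoint unions follow by induction on each event. *)
Lemma described_setI D1 D2 D E1 E2 p1 p2 :
  (forall u, D1 u -> D2 u -> false) ->
  (forall u, D1 u -> D u) -> (forall u, D2 u -> D u) ->
  described D1 E1 p1 -> described D2 E2 p2 -> described D (E1 `&` E2) (p1 * p2).
Proof.
move=> D12 sD1 sD2 d1; elim: d1 E2 p2 => {E1 p1} [s1 kf1 af1 u1 Ds1||E p r _ IH tE pr] E2 p2.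
- elim=> {E2 p2} [s2 kf2 af2 u2 Ds2||E p r _ IH tE pr].
  + pose m (f g : seq nat -> nat) u := if u \in s1 then f u else g u.
    have nin u : u \in s2 -> (u \in s1) = false.
      move=> us2; apply/negP => us1.
      by have := D12 u (allP Ds1 u us1) (allP Ds2 u us2).
    have -> : cyl s1 kf1 af1 `&` cyl s2 kf2 af2 = cyl (s1 ++ s2) (m kf1 kf2) (m af1 af2).
      apply/seteqP; split => [w [h1 h2] u|w h].
        rewrite /= mem_cat /m; case: ifP => [us1 _|_ us2]; first exact: h1.
        exact: h2.
      split => u /= us.
        by have := h u; rewrite /= mem_cat /m us; exact.
      by have := h u; rewrite /= mem_cat /m us (nin u us) orbT; exact.
    have -> : weight s1 kf1 af1 * weight s2 kf2 af2 =
        weight (s1 ++ s2) (m kf1 kf2) (m af1 af2).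
      rewrite /weight big_cat /=; congr (_ * _); apply: eq_big_seq => u us.
        by rewrite /m us.
      by rewrite /m nin.
    apply: described_cyl.
      rewrite cat_uniq u1 u2 andbT /=; apply/hasPn => u /nin; by move=> /= ->.
    by rewrite all_cat (sub_all sD1 Ds1) (sub_all sD2 Ds2).
  + by rewrite setI0 mulr0; exact: described_set0.
  + rewrite setI_bigcupr; apply: described_bigcup IH _ _.
      by apply: trivIset_setIl.
    have -> : series (fun i => weight s1 kf1 af1 * p i) =
        (fun n => weight s1 kf1 af1 * series p n).
      by apply/funext => n; rewrite /series /= mulr_sumr.
    exact: cvgMr.
- by move=> _; rewrite set0I mul0r; exact: described_set0.
- move=> d2; rewrite setI_bigcupl; apply: (described_bigcup _ _ (fun i => p i * p2)).
  + by move=> i; exact: IH.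
  + by apply: trivIset_setIr.
  have -> : series (fun i => p i * p2) = (fun n => series p n * p2).
    by apply/funext => n; rewrite /series /= mulr_suml.
  exact: cvgMl.
Qed.

Lemma described_partition D E (f : T -> nat) p r :
  (forall i, described D (E `&` [set w | f w = i]) (p i)) ->
  series p @ \oo --> r -> described D E r.
Proof.
move=> dE pr; have -> : E = \bigcup_i (E `&` [set w | f w = i]).
  by apply/seteqP; split => [w Ew|w [i _ []]//]; exists (f w).
apply: described_bigcup dE _ pr.
by apply/trivIsetP => i j _ _; apply: contraNeq => /set0P[w [[_ /= <-] [_ <-]]].
Qed.

(** * Adding one generation *)

Section Step.
Variables (B : seq nat -> T -> nat) (l : nat -> R).
Hypothesis dB : forall u j, described (prefix u) [set w | B u w = j] (l j).

Let dB1 u j : described (prefix u) [set w | (B u w - 1)%N = j] (sh l j).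
Proof.
case: j => [|j]; last first.
  rewrite (_ : [set w | _] = [set w | B u w = j.+2]) /=; first exact: dB.
  by apply/funext => w /=; apply/propext; case: (B u w) => [|n]; rewrite ?subn1 /=; split=> [|[]] // ->.
pose p i := if (i <= 1)%N then l i else 0.
apply: (described_partition _ _ (B u) p) => [i|].
  rewrite /p; case: ifP => i1.
    rewrite (_ : _ `&` _ = [set w | B u w = i]); first exact: dB.
    apply/seteqP; split => [w []//|w /= Bi]; split => //.
    by rewrite Bi; move: i1; case: (i) => [|[]].
  rewrite (_ : _ `&` _ = set0); first exact: described_set0.
  apply/seteqP; split => // w /= [+ Bi]; rewrite Bi => /eqP.
  by rewrite subn_eq0 i1.
rewrite (_ : sh l 0 = \sum_(i < 2) p i); last by rewrite big_ord_recr big_ord1.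
by apply: series_finite_support => i; rewrite /p ltnNge => /negbTE ->.
Qed.

Let pv m u w := (A u w + \sum_(i < m) (B (rcons u i) w - 1))%N.

(* law of [A u + \sum_(i < m) (B (rcons u i) - 1)] *)
Fixpoint pc m : nat -> R := if m is m'.+1 then cprod (sh l) (pc m') else mu.

(** The vertex u and the subtrees of its first m children, disjoint from the subtree of child m. *)
Let reg m u v := (v == u) || has (fun i => prefix (rcons u i) v) (iota 0 m).

Let prefix_rcons_inj u v i j : prefix (rcons u i) v -> prefix (rcons u j) v -> i = j.
Proof.
by rewrite !prefixE !size_rcons => /eqP -> /eqP/rcons_inj[].
Qed.

(** [k u] and [A u] share a cylinder, so c stays fixed while children are added one by one; c and m
    are identified in [described_step]. *)
Let dpv m u c j : described (reg m u)
  ([set w | k u w = c] `&` [set w | pv m u w = j]) (q ^+ c * (1 - q) * pc m j).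
Proof.
elim: m j => [|m IH] j.
  have := described_cyl (reg 0 u) [:: u] (fun _ => c) (fun _ => j) isT.
  rewrite /weight big_seq1 /= /reg eqxx /= => /(_ isT).
  congr (described _ _ _); apply/seteqP; split => w.
    move=> h; have [|/= h1 h2] := h u; first by rewrite /= inE.
    by split => //=; rewrite /pv big_ord0 addn0.
  by move=> [/= h1]; rewrite /pv big_ord0 addn0 => h2 v; rewrite /= inE => /eqP ->.
pose p b := if (b <= j)%N then q ^+ c * (1 - q) * pc m (j - b)%N * sh l b else 0.
apply: (described_partition _ _ (fun w => B (rcons u m) w - 1)%N p) => [b|].
  rewrite /p; case: ifP => bj.
    rewrite (_ : _ `&` _ = [set w | k u w = c] `&` [set w | pv m u w = (j - b)%N]
       `&` [set w | (B (rcons u m) w - 1)%N = b]).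
      apply: (described_setI (reg m u) (prefix (rcons u m))) (IH _) (dB1 _ _).
      - move=> v /orP[/eqP ->|/hasP[i]].
          by move=> /size_prefix; rewrite size_rcons ltnn.
        rewrite mem_iota add0n /= => im h1 h2.
        by move: im; rewrite (prefix_rcons_inj _ _ _ _ h1 h2) ltnn.
      - move=> v /orP[/eqP ->|/hasP[i im iv]]; first by rewrite /reg eqxx.
        apply/orP; right; apply/hasP; exists i => //.
        by rewrite -[m.+1]addn1 iotaD mem_cat im.
      - move=> v mv; apply/orP; right; apply/hasP; exists m => //.
        by rewrite mem_iota /=.
    apply/seteqP; split => w /= [[h1 h2] h3].
      split => //; split => //; move: h2; rewrite /pv big_ord_recr /= h3 => <-.
      by rewrite addnA addnK.
    split => //; split => //; rewrite /pv big_ord_recr /= h3 addnA -/(pv m u w) h2.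
    by rewrite subnK.
  rewrite (_ : _ `&` _ = set0); first exact: described_set0.
  apply/seteqP; split => // w /= [[_ +] h3].
  rewrite /pv big_ord_recr /= h3 addnA => h; move: bj; rewrite -h.
  by rewrite leq_addl.
rewrite (_ : _ * _ = \sum_(b < j.+1) p b).
  by apply: series_finite_support => i; rewrite /p ltnNge => /negbTE ->.
rewrite /= /cprod mulr_sumr; apply: eq_bigr => b _.
by rewrite /p -ltnS ltn_ord [sh l b * _]mulrC mulrA.
Qed.

Hypothesis l_ge0 : forall j, 0 <= l j.
Hypothesis l_lt1 : q * sh l 0%N < 1.

Let w_ := res (fun j => (1 - q) * mu j) (fun j => q * sh l j).

Let y_ge0 j : 0 <= q * sh l j. Proof. by rewrite mulr_ge0 // sh_ge0. Qed.
Let nu_ge0 j : 0 <= (1 - q) * mu j.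
Proof. by rewrite mulr_ge0 // subr_ge0 ltW. Qed.
Let w_fix j := res_fix _ (fun j => (1 - q) * mu j) (fun j => q * sh l j) j l_lt1.

(** Removing one child from each term with c > 0 extracts a factor q and a convolution by [sh l]:
    the lack of memory of the geometric law. *)
Let series_pcS n j : series (fun c => q ^+ c * (1 - q) * pc c j) n.+1 =
  (1 - q) * mu j + cprod (fun i => q * sh l i)
    (fun i => series (fun c => q ^+ c * (1 - q) * pc c i) n) j.
Proof.
rewrite /series /= big_mkord big_ord_recl expr0 mul1r; congr (_ + _).
rewrite /cprod; under [RHS]eq_bigr do rewrite big_mkord mulr_sumr.
rewrite exchange_big /=; apply: eq_bigr => c _; rewrite /bump /= add1n /cprod mulr_sumr.
by apply: eq_bigr => i _; rewrite exprS; ring.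
Qed.

(** The partial sums increase and stay below the solution of the convolution equation; their limit
    solves it too, so uniqueness applies. *)
Let series_pc_cvg j : series (fun c => q ^+ c * (1 - q) * pc c j) @ \oo --> w_ j.
Proof.
pose W n j := series (fun c => q ^+ c * (1 - q) * pc c j) n.
have pc0 c i : 0 <= pc c i.
  by elim: c i => [|c IH] i //=; apply: cprod_ge0 => //; exact: sh_ge0.
have W_le n i : W n i <= w_ i.
  elim: n i => [|n IH] i.
    by rewrite /W /series /= big_geq // res_ge0.
  rewrite /W series_pcS /w_ w_fix lerD2l ler_sum // => m _.
  by rewrite ler_wpM2l // IH.
have W_cvg i : cvgn (W ^~ i).
  apply: nondecreasing_is_cvgn; last by exists (w_ i) => _ [n _ <-].
  by apply: nondecreasing_series => c _; rewrite !mulr_ge0 ?exprn_ge0 // subr_ge0 ltW.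
have E i : limn (W ^~ i) = w_ i.
  apply: (res_uniq _ _ (fun j => q * sh l j) (fun i => limn (W ^~ i)) l_lt1) => {}i.
  apply: (cvgn_eq _ (fun n => W n.+1 i)).
    by rewrite (cvg_shiftS (W ^~ i)); exact: W_cvg.
  rewrite (_ : (fun n => _) = (fun n => (1 - q) * mu i + cprod (fun i => q * sh l i) (W n) i)).
    apply: cvgD; first exact: cvg_cst.
    by apply: cvg_sum_ord => m; apply: cvgMr; exact: W_cvg.
  by apply/funext => n; exact: series_pcS.
by rewrite -E; exact: W_cvg.
Qed.

Lemma described_step u j : described (prefix u)
  [set w | (A u w + \sum_(i < k u w) (B (rcons u i) w - 1))%N = j] (w_ j).
Proof.
apply: (described_partition _ _ (k u)) (series_pc_cvg j) => c.
rewrite (_ : _ `&` _ = [set w | k u w = c] `&` [set w | pv c u w = j]); last first.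
  apply/seteqP; split => w /= [h1 h2]; split => //; first by rewrite /pv -h2.
  by rewrite h1.
apply: described_sub (dpv c u c j) => v /orP[/eqP ->|/hasP[i _]].
  exact: prefix_refl.
by apply: prefix_trans; exact: prefix_rcons.
Qed.

End Step.

Lemma described_visits n u j :
  described (prefix u) [set w | visits (k^~ w) (A^~ w) n u = j] (law _ mu q n.+1 j).
Proof.
have l0 m := law_ge0 _ mu mu_ge0 mu_cvg mu_sum q q_ge0 q_lt1 m.
have l1 m := law_input_lt1 _ mu mu_ge0 mu_cvg mu_sum q q_ge0 q_lt1 m.
elim: n u j => [|n IH] u j; last first.
  exact: (described_step _ _ IH (l0 n.+1) (l1 n.+1)).
(* At depth 0 the children contribute B = 0, of law [law q 0], an event described by the empty list
   of words. *)
have := described_step (fun _ _ => 0%N) (law _ mu q 0) _ (l0 0%N) (l1 0%N) u j.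
rewrite (_ : [set w | _ = j] = [set w | visits (k^~ w) (A^~ w) 0 u = j]).
  apply=> v i; case: i => [|i] /=.
    have := described_cyl (prefix v) [::] (fun _ => 0%N) (fun _ => 0%N) isT isT.
    rewrite /weight big_nil; congr (described _ _ _).
    by apply/seteqP; split => // w _ x.
  rewrite (_ : [set w | _] = set0); first exact: described_set0.
  by apply/seteqP; split.
by apply/seteqP; split => w /=; rewrite big1 ?addn0.
Qed.

Lemma visits_nondecreasing (kf af : seq nat -> nat) n u :
  (visits kf af n u <= visits kf af n.+1 u)%N.
Proof.
elim: n u => [|n IH] u; first by rewrite /= leq_addr.
by rewrite [X in (X <= _)%N]/= leq_add2l leq_sum // => i _; rewrite leq_sub2r.
Qed.

Let X n w := Xn (k^~ w) (A^~ w) n.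

Let X_le n m w : (n <= m)%N -> (X n w <= X m w)%N.
Proof.
move=> /subnKC <-; elim: (m - n)%N => [|i IH]; first by rewrite addn0.
by rewrite addnS; apply: leq_trans IH _; exact: visits_nondecreasing.
Qed.

Let X_le_described n K : described (prefix [::]) [set w | (X n w <= K)%N]
  (cumul (law _ mu q n.+1) K).
Proof.
pose p i := if (i <= K)%N then law _ mu q n.+1 i else 0.
apply: (described_partition _ _ (X n) p) => [i|].
  rewrite /p; case: ifP => iK.
    rewrite (_ : _ `&` _ = [set w | X n w = i]); first exact: described_visits.
    by apply/seteqP; split => [w []//|w /= Xi]; split => //=; rewrite Xi.
  rewrite (_ : _ `&` _ = set0); first exact: described_set0.
  by apply/seteqP; split => // w /= [+ Xi]; rewrite Xi iK.
rewrite /cumul (_ : \sum_(_ < _) _ = \sum_(i < K.+1) p i).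
  by apply: series_finite_support => i; rewrite /p ltnNge => /negbTE ->.
by apply: eq_bigr => i _; rewrite /p -ltnS ltn_ord.
Qed.

(** [V K] is the event X <= K and [W] is X < oo. Monotone limits in n, then in K, identify P(W) with
    the total mass of [lawlim]. *)
Lemma subcriticalE : subcritical P k A <-> gf (lawlim _ mu q) 1 = 1.
Proof.
pose V K := \bigcap_n [set w | (X n w <= K)%N].
have mX n K : measurable [set w | (X n w <= K)%N].
  by case: (described_measure _ _ _ (X_le_described n K)).
have mV K : measurable (V K) by exact: bigcapT_measurable.
have PV K : P (V K) = (cumul (lawlim _ mu q) K)%:E.
  have c1 : P [set w | (X n w <= K)%N] @[n --> \oo] --> P (V K).
    apply: (nonincreasing_cvg_mu (mu := P) (F := fun n => [set w | (X n w <= K)%N])) => //.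
    - by rewrite ltey_eq fin_num_measure.
    - exact: mV K.
    move=> n m nm; apply/subsetPset => w /= h; exact: leq_trans (X_le _ _ _ nm) h.
  have c2 : (cumul (law _ mu q n.+1) K)%:E @[n --> \oo] --> (cumul (lawlim _ mu q) K)%:E.
    apply: cvg_EFin; first exact: nearW.
    rewrite (cvg_shiftS (fun n => cumul (law _ mu q n) K)).
    exact: cumul_lawlim.
  have E : (fun n => P [set w | (X n w <= K)%N]) = (fun n => (cumul (law _ mu q n.+1) K)%:E).
    by apply/funext => n; case: (described_measure _ _ _ (X_le_described n K)).
  by rewrite E in c1; rewrite -(cvg_lim _ c1) // (cvg_lim _ c2).
pose W := \bigcup_K V K.
have mW : measurable W by exact: bigcupT_measurable.
have PW : P W = (gf (lawlim _ mu q) 1)%:E.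
  have c1 : P (V K) @[K --> \oo] --> P W.
    apply: (nondecreasing_cvg_mu (mu := P) (F := V)) => //.
    move=> i j ij; apply/subsetPset => w h n _ /=; exact: (leq_trans (h n I)).
  have c2 : (cumul (lawlim _ mu q) K)%:E @[K --> \oo] --> (gf (lawlim _ mu q) 1)%:E.
    apply: cvg_EFin; first exact: nearW.
    rewrite (_ : _ \o _ = (fun K => pseries (lawlim _ mu q) 1 K.+1)).
      apply: cvg_pseriesS; exact: lawlim_cvg1.
    by apply/funext => K /=; rewrite cumul_pseries.
  have E : (fun K => P (V K)) = (fun K => (cumul (lawlim _ mu q) K)%:E).
    by apply/funext.
  by rewrite E in c1; rewrite -(cvg_lim _ c1) // (cvg_lim _ c2).
have -> : subcritical P k A <-> P (~` W) = 0%E.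
  rewrite -negligibleP; last exact: measurableC.
  suff <- : [set w | exists K : nat, forall n, (X n w <= K)%N] = W by split.
  apply/seteqP; split => w /=.
    by move=> [K hK]; exists K => // n _; exact: hK.
  by move=> [K _ hK]; exists K => n; exact: hK.
rewrite probability_setC // PW -EFinB; split => [[]/eqP|->].
  by rewrite subr_eq0 => /eqP.
by rewrite subrr.
Qed.

End ParkingLaw.

(** * The critical set *)

Section Translation.
Variable R : realType.
Implicit Types (mu u : nat -> R) (t l : R).

Lemma nneseries_EFin u : (forall j, 0 <= u j) ->
  (\sum_(j <oo) (u j)%:E < +oo)%E -> series u @ \oo --> fine (\sum_(j <oo) (u j)%:E)%E.
Proof.
move=> u0 uoo; set S := (\sum_(j <oo) _)%E in uoo *.
have fS : S \is a fin_num.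
  by rewrite ge0_fin_numE //; apply: nneseries_ge0 => i _ _; rewrite lee_fin.
have E : (fun n => \sum_(0 <= i < n) (u i)%:E)%E = EFin \o series u.
  by apply/funext => n /=; rewrite sumEFin.
have cu : cvgn (series u).
  apply: nondecreasing_is_cvgn; first exact: nondecreasing_series.
  exists (fine S) => _ [n _ <-]; rewrite -lee_fin fineK // /series /= -sumEFin.
  by apply: nneseries_lim_ge => i _; rewrite lee_fin.
rewrite /S E EFin_lim //=; exact: cu.
Qed.

Lemma series_shift u l : u 0%N = 0 -> series u @ \oo --> l ->
  series (fun j => u j.+1) @ \oo --> l.
Proof.
move=> u0; rewrite -(cvg_shiftS (series u)).
rewrite (_ : (fun n => series u n.+1) = series (fun j => u j.+1)) //.
by apply/funext => n; rewrite /series /= big_nat_recl // u0 add0r.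
Qed.

Lemma cvgn_gf u t l : pseries u t @ \oo --> l -> cvgn (pseries u t) /\ gf u t = l.
Proof. by move=> ul; split; [apply/cvg_ex; exists l|exact: cvg_lim]. Qed.

Variable mu : nat -> R.
Hypothesis mu_ge0 : forall j, 0 <= mu j.

Lemma Gf_gf t : 0 <= t -> (Gf mu t < +oo)%E ->
  cvgn (pseries mu t) /\ gf mu t = fine (Gf mu t).
Proof.
move=> t0 h; apply: cvgn_gf; apply: (nneseries_EFin _ _ h) => j.
by rewrite mulr_ge0 // exprn_ge0.
Qed.

Lemma G1_gf t : 0 <= t -> (G1 mu t < +oo)%E ->
  cvgn (pseries (pseries_diffs mu) t) /\ gf (pseries_diffs mu) t = fine (G1 mu t).
Proof.
move=> t0 h; apply: cvgn_gf.
have u0 j : 0 <= j%:R * mu j * t ^+ j.-1 by rewrite !mulr_ge0 // exprn_ge0.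
by apply: series_shift (nneseries_EFin _ u0 h); rewrite !mul0r.
Qed.

Lemma G2_gf t : 0 <= t -> (G2 mu t < +oo)%E ->
  cvgn (pseries (pseries_diffs (pseries_diffs mu)) t) /\
  gf (pseries_diffs (pseries_diffs mu)) t = fine (G2 mu t).
Proof.
move=> t0 h; apply: cvgn_gf.
have u0 j : 0 <= j%:R * j.-1%:R * mu j * t ^+ j.-2 by rewrite !mulr_ge0 // exprn_ge0.
have h1 : series (fun j => j.+1%:R * j%:R * mu j.+1 * t ^+ j.-1) @ \oo --> fine (G2 mu t).
  by apply: series_shift (nneseries_EFin _ u0 h); rewrite !mul0r.
have h2 : series (fun j => j.+2%:R * j.+1%:R * mu j.+2 * t ^+ j) @ \oo --> fine (G2 mu t).
  by apply: series_shift h1; rewrite mulr0 !mul0r.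
rewrite /pseries (_ : (fun j => _ * _) = (fun j => j.+2%:R * j.+1%:R * mu j.+2 * t ^+ j)) //.
by apply/funext => j; rewrite /pseries_diffs; ring.
Qed.

Let d1 := pseries_diffs mu.
Let d2 := pseries_diffs d1.

Let diffs_lag : pseries_diffs (lag mu) = fun j => lag d1 j + mu j.
Proof.
by apply/funext => -[|j]; rewrite /d1 /pseries_diffs /= -?natr1; ring.
Qed.

Let diffs2_lag : pseries_diffs (pseries_diffs (lag mu)) =
  fun j => lag d2 j + 2 * d1 j.
Proof.
rewrite diffs_lag; apply/funext => -[|j]; rewrite /d2 /d1 /pseries_diffs /= -?natr1; ring.
Qed.

Lemma lag_order2 t : cvgn (pseries mu t) -> cvgn (pseries d1 t) ->
  cvgn (pseries d2 t) ->
  [/\ cvg_order2 _ (lag mu) t,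
    gf (pseries_diffs (lag mu)) t = t * gf d1 t + gf mu t &
    gf (pseries_diffs (pseries_diffs (lag mu))) t = t * gf d2 t + 2 * gf d1 t].
Proof.
move=> c0 c1 c2; have z1 := is_cvg_pseriesZ _ 2 _ _ c1.
split; last 2 first.
- by rewrite diffs_lag gfD ?gf_lag //; exact: cvg_lag.
- by rewrite diffs2_lag gfD ?gf_lag ?gfZ //; exact: cvg_lag.
split; first exact: cvg_lag.
  rewrite diffs_lag; apply/cvg_ex; eexists; apply: cvg_pseriesD => //; exact: cvg_lag.
rewrite diffs2_lag; apply/cvg_ex; eexists; apply: cvg_pseriesD => //; exact: cvg_lag.
Qed.

(** For H = t G, 2 H H'' - H'^2 expands to 2 t^2 G G'' - (G - t G')^2. *)
Lemma crit_set_inflex t : crit_set mu t ->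
  [/\ 0 < t, cvg_order2 _ (lag mu) t & inflex _ (lag mu) t = 0].
Proof.
move=> [t0 [/(Gf_gf t (ltW t0)) [c0 e0] [/(G1_gf t (ltW t0)) [c1 e1]]]].
move=> [/(G2_gf t (ltW t0)) [c2 e2]]; rewrite -e0 -e1 -e2 => E.
have [co h1 h2] := lag_order2 t c0 c1 c2.
by split => //; rewrite /inflex h1 h2 gf_lag // -/d1 -/d2; move: E; rewrite -/d1 -/d2; lra.
Qed.

Lemma crit_set_phi t : crit_set mu t ->
  phi mu t = phi_lag _ mu t /\ t * fine (Gf mu t) = gf (lag mu) t.
Proof.
move=> [t0 [/(Gf_gf t (ltW t0)) [c0 e0] [/(G1_gf t (ltW t0)) [c1 e1]]]].
move=> [/(G2_gf t (ltW t0)) [c2 _] _].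
have [_ h1 _] := lag_order2 t c0 c1 c2.
by rewrite /phi /phi_lag h1 gf_lag // -e0 -e1 -/d1; split => //; ring.
Qed.

End Translation.

Theorem theorem1 (R : realType) (q : R) (mu : nat -> R)
  (d : measure_display) (T : measurableType d) (P : probability T R)
  (k A : seq nat -> T -> nat) :
  1 / 2 < q -> q < 1 ->
  prob_law_nat mu -> mu 0%N + mu 1%N < 1 ->
  GW_parking_law P q mu k A ->
  crit_set mu !=set0 ->
  subcritical P k A <->
  (1 < inf (crit_set mu) /\
   inf (crit_set mu) * fine (Gf mu (inf (crit_set mu)))
     / (phi mu (inf (crit_set mu))) ^+ 2 <= q * (1 - q)).
Proof.
move=> q_gt q1 [mu0 mu1] mu01 parking [t critt].
have q0 : 0 <= q by lra.
have mus : pseries mu 1 @ \oo --> (1 : R).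
  rewrite (_ : pseries mu 1 = series mu) //; apply/funext => n.
  by rewrite /pseries /series /=; under eq_bigr do rewrite expr1n mulr1.
have [mu_cvg mu_sum] := cvgn_gf _ _ _ _ mus.
have mu_nt : exists2 j, (2 <= j)%N & 0 < mu j.
  apply: contrapT => nt; have mu2 i : (1 < i)%N -> mu i = 0.
    move=> i1; apply/eqP; rewrite eq_le mu0 andbT leNgt; apply/negP => mui.
    by apply: nt; exists i.
  have := cvgn_eq _ _ _ _ mu1 (series_finite_support _ mu 1 mu2).
  by rewrite big_ord_recr big_ord1 /= => E; move: mu01; rewrite -E ltxx.
have lag0 := lag_ge0 _ mu mu0.
have lag_nt : exists2 j, (3 <= j)%N & 0 < lag mu j.
  by case: mu_nt => j j2 muj; exists j.+1.
(* [inflex] is strictly increasing, so its zero is unique and the infimum is attained. *)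
have crit1 : crit_set mu = [set t].
  apply/seteqP; split => [s crits|_ ->//].
  have [s0 cs is0] := crit_set_inflex _ mu mu0 s crits.
  have [t0 ct it] := crit_set_inflex _ mu mu0 t critt.
  have lt := inflex_lt _ _ lag0 lag_nt.
  case: (ltgtP s t) => // st.
    by have := lt s t (ltW s0) st ct; rewrite is0 it ltxx.
  by have := lt t s (ltW t0) st cs; rewrite is0 it ltxx.
rewrite crit1 inf1.
have [t0 ct it] := crit_set_inflex _ mu mu0 t critt.
have [-> ->] := crit_set_phi _ mu mu0 t critt.
rewrite (subcriticalE _ _ _ P q mu k A q0 q1 mu0 mu_cvg mu_sum parking).
split.
  move=> a1.
  have nec := necessary_condition _ mu t mu0 mu_cvg mu_sum mu_nt t0 ct it q q_gt q1 a1.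
  split; first exact: (tc_gt1_of_sum1 _ mu t mu0 mu_cvg mu_sum mu_nt t0 ct it q).
  (* Division by zero yields 0, which settles this case. *)
  have [->|phi0] := eqVneq (phi_lag _ mu t) 0.
    by rewrite expr0n invr0 mulr0 mulr_ge0 // subr_ge0 ltW.
  by rewrite ler_pdivrMr // exprn_even_gt0.
move=> [t1]; rewrite ler_pdivrMr; last first.
  by rewrite exprn_gt0 // (phi_lag_gt0 _ mu t).
exact: (sufficient_condition _ mu t).
Qed.
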